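(* Let $p$ be a real number, and let $X=1+x_1+x_2+\cdots$ (with $x_i\in\mathcal H_K$ homogeneous of degree $i$) be the solution of the combinatorial Dyson-Schwinger equation $X=1+B_+(X^p)$ in the Connes-Kreimer Hopf algebra $\mathcal H_K$. Then for all $n\ge1$ $$\Delta(x_n)=x_n\otimes1+\sum_{k=1}^n q_{n,k}(x_1,x_2,\dots)\otimes x_k,$$ where $q_{n,n}=1$ and, for $1\le k<n$, $$q_{n,k}(x_1,x_2,\dots)=\sum_{i_1+2i_2+\cdots=n-k}\binom{k(p-1)+1}{i_1+i_2+\cdots}\frac{(i_1+i_2+\cdots)!}{i_1!\,i_2!\cdots}\,x_1^{i_1}x_2^{i_2}\cdots,$$ the sum being over sequences $(i_1,i_2,\dots)$ of nonnegative integers with $i_1+2i_2+3i_3+\cdots=n-k$.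
   Context: The base field has characteristic $0$ and is taken to contain $\mathbb R$. For real $a$ and integer $m\ge0$, $\binom am=\frac{a(a-1)\cdots(a-m+1)}{m!}$. A rooted tree is a finite poset with a unique maximal element (the root) such that for each element (vertex) $v$ the set of elements exceeding $v$ is a chain; it is viewed as a directed graph with an edge from each vertex to each of its children. Rooted trees are considered up to isomorphism and $|t|$ is the number of vertices. The Connes-Kreimer Hopf algebra $\mathcal H_K$ is, as an algebra, the free commutative algebra on rooted trees (with basis the forests, i.e. commutative monomials in rooted trees), graded by $|t_1\cdots t_k|=|t_1|+\cdots+|t_k|$. The coproduct is multiplicative and on a rooted tree $t$ is $\Delta(t)=t\otimes1+\sum_cP^c(t)\otimes R^c(t)$, over all admissible cuts $c$ of $t$: a cut is a subset of the edges, it is admissible if every path from the root to a leaf meets it at most once (the empty cut is admissible), and after removing the edges of $c$, $R^c(t)$ is the component containing the root and $P^c(t)$ is the forest of the remaining components. $B_+$ is the linear map sending a forest $t_1\cdots t_k$ to the rooted tree obtained by attaching a new root vertex to each of the roots of $t_1,\dots,t_k$, with $B_+(1)=\bullet$ (the one-vertex tree); it is extended to formal sums degree by degree. With $\bar X=x_1+x_2+\cdots$, $X^p$ means $(1+\bar X)^p=\sum_{j\ge0}\binom pj\bar X^j$. The equation determines the $x_n$ recursively: $x_1=\bullet$ and $x_{n+1}$ is $B_+$ of the degree-$n$ part of $\sum_{j\ge0}\binom pj\bar X^j$. *)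

(* Defs.v *)
From HB Require Import structures.
From mathcomp Require Import all_boot all_order all_algebra.
From mathcomp Require Import finmap monalg.
From mathcomp Require Import boolp reals.

Set Implicit Arguments.
Unset Strict Implicit.
Unset Printing Implicit Defensive.

Import GRing.Theory.
Local Open Scope ring_scope.

(* Rooted trees are ordered with the root as greatest element. *)
Section Posets.
Variables (T : finType) (le : rel T).

Definition poset_lt : rel T := fun x y => (x != y) && le x y.

Definition is_maximal : pred T := fun x => [forall y, ~~ poset_lt x y].

Definition is_poset : bool :=
  [&& [forall x, le x x],
      [forall x, forall y, le x y && le y x ==> (x == y)] &
      [forall x, forall y, forall z, le x y && le y z ==> le x z]].

Definition rooted_tree : bool :=
  [&& is_poset, #|[pred x | is_maximal x]| == 1%N &
      [forall v, forall x, forall y,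
         poset_lt v x && poset_lt v y ==> le x y || le y x]].

(* [tree_edge u v]: there is an edge from [u] to its child [v]. *)
Definition tree_edge : rel T :=
  fun u v => poset_lt v u && [forall z, ~~ (poset_lt v z && poset_lt z u)].

Definition is_leaf : pred T := fun v => [forall w, ~~ tree_edge v w].

Definition tree_edges : {set T * T} := [set e | tree_edge e.1 e.2].

(* [pairmap pair r s] lists the edges of the directed path [r :: s]. *)
Definition admissible (c : {set T * T}) : Prop :=
  c \subset tree_edges /\
  forall (r : T) (s : seq T),
    is_maximal r -> path tree_edge r s -> is_leaf (last r s) ->
    (count (mem c) (pairmap pair r s) <= 1)%N.

(* Adjacency, ignoring orientation, after removing the edges in [c]. *)
Definition residual (c : {set T * T}) : rel T :=
  fun u v => (tree_edge u v && ((u, v) \notin c))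
          || (tree_edge v u && ((v, u) \notin c)).

Definition component (c : {set T * T}) (x : T) : {set T} :=
  [set y | connect (residual c) x y].

Definition components (c : {set T * T}) : {set {set T}} :=
  [set component c x | x : T].

Definition root_component (c : {set T * T}) : {set T} :=
  [set y | [exists r, is_maximal r && (y \in component c r)]].

Definition induced_le (C : {set T}) : rel {x : T | x \in C} :=
  fun x y => le (val x) (val y).

End Posets.

Definition poset_iso (T U : finType) (r : rel T) (s : rel U) : Prop :=
  exists2 f : T -> U, bijective f & forall x y, r x y = s (f x) (f y).

Lemma poset_iso_refl (T : finType) (r : rel T) : poset_iso r r.
Proof. by exists id => //; exists id. Qed.

Lemma poset_iso_sym (T U : finType) (r : rel T) (s : rel U) :
  poset_iso r s -> poset_iso s r.
Proof.
move=> [f [g fK gK] rs]; exists g; first by exists f.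
by move=> x y; rewrite rs !gK.
Qed.

Lemma poset_iso_trans (T U V : finType) (r : rel T) (s : rel U) (t : rel V) :
  poset_iso r s -> poset_iso s t -> poset_iso r t.
Proof.
move=> [f f_bij rs] [g g_bij st]; exists (g \o f); first exact: bij_comp.
by move=> x y; rewrite rs st.
Qed.

Lemma poset_iso_rooted (T U : finType) (r : rel T) (s : rel U) :
  poset_iso r s -> rooted_tree r -> rooted_tree s.
Proof.
move=> [f [g fK gK] rs].
have sr x y : s x y = r (g x) (g y) by rewrite rs !gK.
have lt_sr x y : poset_lt s x y = poset_lt r (g x) (g y).
  by rewrite /poset_lt sr (can_eq gK).
case/and3P=> /and3P[/forallP rr /'forall_'forall_implyP ra /'forall_'forall_forallP rt].
move=> /eqP r1 /'forall_'forall_forallP rc; apply/and3P; split.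
- apply/and3P; split.
  + by apply/forallP => x; rewrite sr.
  + apply/'forall_'forall_implyP => x y; rewrite !sr => /ra.
    by rewrite (can_eq gK).
  + apply/'forall_'forall_forallP => x y z; rewrite !sr; exact: rt.
- rewrite -r1 -[X in _ == X](card_image (can_inj fK)); apply/eqP/eq_card => y.
  apply/idP/imageP => [/forallP ymax|[x /forallP xmax ->]].
    exists (g y); rewrite ?gK //; apply/forallP => z.
    by have := ymax (f z); rewrite lt_sr fK.
  by apply/forallP => z; rewrite lt_sr fK.
- by apply/'forall_'forall_forallP => v x y; rewrite !lt_sr !sr; exact: rc.
Qed.

(* Rooted trees up to isomorphism: orders on the vertex sets ['I_n], modulo    *)
(* isomorphism.                                                               *)
Definition labelled_rel : Type := {n : nat & {ffun 'I_n * 'I_n -> bool}}.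

Definition labelled_le (s : labelled_rel) : rel 'I_(tag s) :=
  fun x y => tagged s (x, y).

Definition ltree := {s : labelled_rel | rooted_tree (@labelled_le s)}.

Definition ltree_le (t : ltree) : rel 'I_(tag (val t)) :=
  @labelled_le (val t).

Definition ltree_iso (s t : ltree) : bool :=
  `[< poset_iso (@ltree_le s) (@ltree_le t) >].

Lemma ltree_iso_refl : reflexive ltree_iso.
Proof. by move=> t; apply/asboolP; exact: poset_iso_refl. Qed.

Lemma ltree_iso_sym : symmetric ltree_iso.
Proof.
by move=> s t; apply/asboolP/asboolP; exact: poset_iso_sym.
Qed.

Lemma ltree_iso_trans : transitive ltree_iso.
Proof.
move=> t s u /asboolP st /asboolP tu; apply/asboolP.
exact: poset_iso_trans tu.
Qed.

Canonical ltree_equiv :=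
  EquivRel ltree_iso ltree_iso_refl ltree_iso_sym ltree_iso_trans.

Definition rtree := {eq_quot ltree_equiv}%qT.

Definition tree_size (t : rtree) : nat := tag (val (repr t)).

Definition vertex (t : rtree) : finType := 'I_(tree_size t).

Definition vertex_le (t : rtree) : rel (vertex t) := @ltree_le (repr t).

Definition label_rel (T : finType) (le : rel T) : labelled_rel :=
  Tagged (fun n => {ffun 'I_n * 'I_n -> bool})
    [ffun p : 'I_#|T| * 'I_#|T| => le (enum_val p.1) (enum_val p.2)].

Lemma label_rel_iso (T : finType) (le : rel T) :
  poset_iso le (@labelled_le (label_rel le)).
Proof.
exists enum_rank; first exact: enum_rank_bij.
by move=> x y; rewrite /labelled_le /= ffunE /= !enum_rankK.
Qed.

Lemma one_vertex_rooted : rooted_tree (fun _ _ : unit => true).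
Proof.
apply/and3P; split.
- apply/and3P; split; first exact/forallP.
    by apply/'forall_'forall_implyP => -[] [].
  by apply/'forall_'forall_forallP.
- apply/eqP; rewrite -card_unit; apply/eq_card => -[].
  by apply/forallP => -[].
- by apply/'forall_'forall_forallP => -[] [].
Qed.

Definition one_vertex_ltree : ltree :=
  Sub (label_rel (fun _ _ : unit => true))
    (poset_iso_rooted (label_rel_iso _) one_vertex_rooted).

(* The isomorphism class of the rooted tree [le] (a dummy value if [le] is    *)
(* not one; see [component_rooted] and [graft_rooted] for the uses below).    *)
Definition tree_of (T : finType) (le : rel T) : rtree :=
  (\pi_rtree (insubd one_vertex_ltree (label_rel le)))%qT.

Lemma tree_ofP (T : finType) (le : rel T) :
  rooted_tree le -> poset_iso le (@vertex_le (tree_of le)).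
Proof.
move=> rt; have iso_l := label_rel_iso le.
apply: poset_iso_trans iso_l _.
have rl := poset_iso_rooted (label_rel_iso le) rt.
have : ltree_iso (insubd one_vertex_ltree (label_rel le)) (repr (tree_of le)).
  have /eqmodP // : insubd one_vertex_ltree (label_rel le)
                    = repr (tree_of le) %[mod rtree]%qT.
  by rewrite reprK.
move=> /asboolP; rewrite /ltree_le /insubd; case: insubP => [u _ <- //|].
by rewrite rl.
Qed.

Lemma component_rooted (T : finType) (le : rel T) (c : {set T * T}) (x : T) :
  rooted_tree le -> rooted_tree (induced_le le (C := component le c x)).
Proof.
case/and3P=> /and3P[/forallP lexx /'forall_'forall_implyP leas /'forall_'forall_forallP letr].
move=> _ /'forall_'forall_forallP lech; set C := component le c x.
have lt_le u v : poset_lt le u v -> le u v by case/andP.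
have lt_val (u v : {y | y \in C}) :
    poset_lt (induced_le le (C := C)) u v = poset_lt le (val u) (val v).
  by rewrite /poset_lt (inj_eq val_inj).
have letrans u v w : le u v -> le v w -> le u w.
  by move=> uv vw; have /implyP := letr u v w; apply; rewrite uv vw.
have ressym : connect_sym (residual le c).
  by apply: sym_connect_sym => u v; rewrite /residual orbC.
have maxC (a y : T) :
    a \in C -> {in C, forall z, ~~ poset_lt le a z} -> y \in C -> le y a.
  rewrite inE => xa amax; rewrite inE => xy.
  have : connect (residual le c) a y by rewrite (connect_trans _ xy) // ressym.
  case/connectP=> s; elim/last_ind: s y {xy} => [|s z IHs] y /=.
    by move=> _ ->; exact: lexx.
  rewrite rcons_path last_rcons => /andP[pas yz ->].
  have {IHs} lea := IHs _ pas erefl; set w := last a s in yz lea.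
  have aw : connect (residual le c) a w by apply/connectP; exists s.
  have zC : z \in C.
    by rewrite inE (connect_trans xa) // (connect_trans aw) // connect1.
  case/orP: yz => /andP[/andP[zw /forallP cov] _].
    exact: letrans (lt_le _ _ zw) lea.
  have [wa|wa] := eqVneq w a; first by have := amax z zC; rewrite -wa zw.
  have wlta : poset_lt le w a by rewrite /poset_lt wa.
  have /implyP/(_ _)/orP[|//|az] := lech w z a; first by rewrite zw.
  have [->|za] := eqVneq z a; first exact: lexx.
  by have := cov a; rewrite wlta /= /poset_lt eq_sym za az.
apply/and3P; split.
- apply/and3P; split.
  + by apply/forallP => u; exact: lexx.
  + by apply/'forall_'forall_implyP => u v /leas; rewrite (inj_eq val_inj).
  + by apply/'forall_'forall_forallP => u v w; exact: letr.
- have [a aC amax] : exists2 a, a \in C & {in C, forall z, ~~ poset_lt le a z}.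
    have xC : x \in C by rewrite inE.
    pose up u := #|[set v in C | poset_lt le u v]|.
    case: (arg_minnP up xC) => a aC amin; exists a => // z zC.
    apply/negP => az; have := amin z zC; rewrite leqNgt => /negP; apply.
    apply/proper_card/properP; split.
      apply/subsetP => v; rewrite !inE => /andP[-> zv] /=.
      have av := letrans _ _ _ (lt_le _ _ az) (lt_le _ _ zv).
      rewrite /poset_lt av andbT; apply/eqP => eav; move: zv az.
      rewrite -eav => /andP[_ za] /andP[/eqP naz az]; case: naz.
      by apply/eqP/leas; rewrite az za.
    exists z; first by rewrite inE zC.
    by rewrite inE /poset_lt eqxx andbF.
  apply/eqP; rewrite -(card1 (Sub a aC : {y | y \in C})).
  apply/eq_card => u; rewrite !inE; apply/idP/eqP => [/forallP umax|->].
    have := umax (Sub a aC); rewrite lt_val /poset_lt /= maxC ?(valP u) //.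
    by rewrite andbT negbK => /eqP ua; apply/val_inj.
  by apply/forallP => v; rewrite lt_val; exact: amax (valP v).
- by apply/'forall_'forall_forallP => v y z; rewrite !lt_val; exact: lech.
Qed.

(* The poset obtained by adding a root [None] above a family of posets. *)
Definition graft_le (n : nat) (T : 'I_n -> finType)
    (le : forall i, rel (T i)) : rel (option {i : 'I_n & T i}) :=
  fun x y => match x, y with
  | _, None => true
  | None, Some _ => false
  | Some u, Some v =>
      (tag u == tag v) && le (tag u) (tagged u) (tagged_as u v)
  end.

Lemma graft_rooted (n : nat) (T : 'I_n -> finType) (le : forall i, rel (T i)) :
  (forall i, rooted_tree (le i)) -> rooted_tree (graft_le le).
Proof.
move=> rt.
have gle i (u v : T i) :
    graft_le le (Some (Tagged T u)) (Some (Tagged T v)) = le i u v.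
  by rewrite /graft_le /= eqxx tagged_asE.
have gtag (u v : {i & T i}) :
    graft_le le (Some u) (Some v) -> tag u = tag v by case/andP=> /eqP.
have geq i (u v : T i) :
    (Some (Tagged T u) == Some (Tagged T v)) = (u == v).
  by rewrite (inj_eq Some_inj) -tag_eqE /tag_eq /= eqxx tagged_asE.
apply/and3P; split.
- apply/and3P; split.
  + apply/forallP => -[[i u]|//]; rewrite gle.
    by case/and3P: (rt i) => /and3P[/forallP].
  + apply/'forall_'forall_implyP => -[[i u]|] [[j v]|] //.
    case/andP=> uv; have eij : i = j := gtag _ _ uv; subst j.
    move: uv; rewrite !gle geq => uv vu.
    case/and3P: (rt i) => /and3P[_ /'forall_'forall_implyP leas _] _ _.
    by apply: leas; rewrite uv.
  + apply/'forall_'forall_forallP => -[[i u]|] [[j v]|] [[l w]|];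
      try by rewrite /= ?andbF ?implybT.
    apply/implyP => /andP[uv vw]; have eij : i = j := gtag _ _ uv; subst j.
    have eil : i = l := gtag _ _ vw; subst l; move: uv vw; rewrite !gle => uv vw.
    case/and3P: (rt i) => /and3P[_ _ /'forall_'forall_forallP letr] _ _.
    by have /implyP := letr u v w; apply; rewrite uv.
- apply/eqP; rewrite -(card1 (None : option {i & T i})).
  apply/eq_card => u; rewrite !inE; apply/idP/eqP => [/forallP/(_ None)|->].
    by case: u.
  by apply/forallP => -[].
- apply/'forall_'forall_forallP => -[[i w]|] [[j u]|] [[l v]|];
    try by rewrite /= ?orbT ?implybT.
  apply/implyP => /andP[/andP[nwu wu] /andP[nwv wv]].
  have eij : i = j := gtag _ _ wu; subst j; have eil : i = l := gtag _ _ wv; subst l.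
  move: nwu nwv wu wv; rewrite !geq !gle => nwu nwv wu wv.
  case/and3P: (rt i) => _ _ /'forall_'forall_forallP lech.
  by have /implyP := lech w u v; apply; rewrite /poset_lt nwu nwv wu.
Qed.

(* Forests: finite multisets of rooted trees. *)
Notation forest := {cmonom rtree}.

Definition forest_size (f : forest) : nat :=
  (\sum_(t <- finsupp f) f t * tree_size t)%N.

Definition forest_seq (f : forest) : seq rtree :=
  flatten [seq nseq (f t) t | t <- finsupp f].

Definition graft (f : forest) : rtree :=
  tree_of (graft_le (fun i => @vertex_le (tnth (in_tuple (forest_seq f)) i))).

(* Pairs of forests are the monomials of H_K (x) H_K, with componentwise       *)
(* product: (a (x) b) (c (x) d) = ac (x) bd.                                    *)
Section PairMonomial.
Variables M N : conomType.

Definition pair_mone : M * N := (mone, mone).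
Definition pair_mmul (x y : M * N) : M * N := (mmul x.1 y.1, mmul x.2 y.2).

Lemma pair_mmulA : associative pair_mmul.
Proof. by move=> x y z; rewrite /pair_mmul /= !mulmA. Qed.
Lemma pair_mul1m : left_id pair_mone pair_mmul.
Proof. by case=> x y; rewrite /pair_mmul /= !mul1m. Qed.
Lemma pair_mulm1 : right_id pair_mone pair_mmul.
Proof. by case=> x y; rewrite /pair_mmul /= !mulm1. Qed.
Lemma pair_unitm x y :
  pair_mmul x y = pair_mone -> x = pair_mone /\ y = pair_mone.
Proof.
by case: x y => [x1 x2] [y1 y2] [] /unitm[-> ->] /unitm[-> ->].
Qed.
Lemma pair_mmulC : commutative pair_mmul.
Proof. by move=> x y; rewrite /pair_mmul mulmC [X in (_, X)]mulmC. Qed.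

HB.instance Definition _ := Choice_isMonomialDef.Build (M * N)%type
  pair_mmulA pair_mul1m pair_mulm1 pair_unitm.
HB.instance Definition _ := MonomialDef_isConomialDef.Build (M * N)%type
  pair_mmulC.
End PairMonomial.

Notation HK K := {malg K[forest]}.
Notation HK2 K := {malg K[(forest * forest)%type]}.

Section ConnesKreimer.
Variable K : fieldType.

Local Notation HK := (HK K).
Local Notation HK2 := (HK2 K).

Definition tree_gen (t : rtree) : HK := << ucm t >>.

(* [tensor a b] is a (x) b, expanded on the basis of pairs of forests. *)
Definition tensor (a b : HK) : HK2 :=
  \sum_(f <- msupp a) \sum_(g <- msupp b) << a@_f * b@_g *g (f, g) >>.

(* [Rcut t c] and [Pcut t c] are R^c(t) and P^c(t). *)
Definition Rcut (t : rtree) (c : {set vertex t * vertex t}) : HK :=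
  tree_gen (tree_of (induced_le (@vertex_le t)
                       (C := root_component (@vertex_le t) c))).

Definition Pcut (t : rtree) (c : {set vertex t * vertex t}) : HK :=
  \prod_(C in components (@vertex_le t) c :\ root_component (@vertex_le t) c)
     tree_gen (tree_of (induced_le (@vertex_le t) (C := C))).

Definition coproduct_tree (t : rtree) : HK2 :=
  tensor (tree_gen t) 1 +
  \sum_(c : {set vertex t * vertex t} | `[< admissible (@vertex_le t) c >])
     tensor (Pcut c) (Rcut c).

Definition coproduct (a : HK) : HK2 :=
  \sum_(f <- msupp a)
     a@_f *: \prod_(t <- finsupp f) coproduct_tree t ^+ f t.

Definition homogeneous (n : nat) (a : HK) : Prop :=
  forall f, f \in msupp a -> forest_size f = n.

Definition Bplus (a : HK) : HK :=
  \sum_(f <- msupp a) a@_f *: tree_gen (graft f).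

(* A formal sum of elements of H_K of increasing degrees is represented by     *)
(* the sequence of its homogeneous parts.                                     *)
Definition formal_sum : Type := nat -> HK.

Definition fs_one : formal_sum := fun n => (n == 0%N)%:R.

Definition fs_add (A B : formal_sum) : formal_sum := fun n => A n + B n.

Definition fs_mul (A B : formal_sum) : formal_sum :=
  fun n => \sum_(i < n.+1) A i * B (n - i)%N.

Definition fs_exp (A : formal_sum) (j : nat) : formal_sum :=
  iter j (fs_mul A) fs_one.

(* [Bplus] raises degrees by one, so it shifts the sequence of parts. *)
Definition fs_Bplus (A : formal_sum) : formal_sum :=
  fun n => if n is m.+1 then Bplus (A m) else 0.

(* [emb] is the inclusion of the real numbers in the base field. *)
Variables (R : realType) (emb : {rmorphism R -> K}).

Definition gbinom (a : R) (m : nat) : R :=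
  (\prod_(i < m) (a - i%:R)) / (m`!)%:R.

Definition fs_bar (X : formal_sum) : formal_sum :=
  fun n => if n is 0 then 0 else X n.

(* The sum over all j >= 0 stops at j = n in degree n, since Xbar starts in    *)
(* degree 1.                                                                  *)
Definition fs_rpow (X : formal_sum) (p : R) : formal_sum :=
  fun n => \sum_(j < n.+1) emb (gbinom p j) *: fs_exp (fs_bar X) j n.

Definition DSE_solution (p : R) (X : formal_sum) : Prop :=
  X 0%N = 1 /\ (forall n, homogeneous n (X n)) /\
  X =1 fs_add fs_one (fs_Bplus (fs_rpow X p)).

(* [i m] stands for the exponent i_{m+1}; as i_1 + 2 i_2 + ... = n - k, all     *)
(* exponents are at most n - k and those of index greater than n - k vanish.  *)
Definition dse_coeff (p : R) (x : nat -> HK) (n k : nat) : HK :=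
  if k == n then 1 else
  \sum_(i : {ffun 'I_(n - k) -> 'I_(n - k).+1} |
          (\sum_(m < n - k) m.+1 * i m == n - k)%N)
     (emb (gbinom (k%:R * (p - 1) + 1) (\sum_(m < n - k) i m)%N)
        * ((\sum_(m < n - k) i m)%N`!%:R / \prod_(m < n - k) (i m)`!%:R))
     *: \prod_(m < n - k) x m.+1 ^+ i m.

End ConnesKreimer.

(* Main.v *)
Require Import Defs.
From HB Require Import structures.
From mathcomp Require Import all_boot all_order all_algebra.
From mathcomp Require Import finmap monalg.
From mathcomp Require Import boolp reals.
From mathcomp Require Import ring.

(** The coproduct becomes transparent on finite posets in which every principal
    upset is a chain: admissible cuts of a tree [t] correspond to its nonempty
    upsets [U], with [R^c] the tree [U] and [P^c] the forest [~: U], while the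
    empty upset accounts for [t (x) 1].  Hence the coproduct of a forest is the
    sum of [~: U (x) U] over all upsets [U], which is visibly multiplicative on
    disjoint unions, and adding a root gives the cocycle identity
    [Delta (B_+ a) = B_+ a (x) 1 + (id (x) B_+) (Delta a)].

    With [Y = X (x) 1], [Z = 1 (x) X] and [Q = Y^(p-1)], the claim is that
    [Delta X = Y * Z(Q)], where [Z(Q)] rescales the degree-[k] part of [Z] by
    [Q^k].  If it holds up to degree [n], taking [p]-th powers gives
    [Delta (X^p) = Y^p * Z^p(Q)] in degree [n], and the cocycle identity turns
    this into the claim in degree [n+1].  The laws of real powers are obtained
    from the differential equation [F (F^a)' = a F' F^a], and the explicit
    coefficients from the multinomial theorem. *)

Set Implicit Arguments.
Unset Strict Implicit.
Unset Printing Implicit Defensive.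

Import GRing.Theory.
Local Open Scope ring_scope.

(** * Forest posets *)

(** Rooted trees without the requirement of a root: this class is stable under passing to subsets,
    so complements of upsets and branches are treated like whole trees. *)
Definition forest_poset (T : finType) (le : rel T) : Prop :=
  [/\ reflexive le, antisymmetric le, transitive le &
      forall v x y, le v x -> le v y -> le x y || le y x].

Lemma rooted_treeP (T : finType) (le : rel T) :
  rooted_tree le <-> forest_poset le /\ exists r, forall x, le x r.
Proof.
split.
- case/and3P=> /and3P[/forallP rr /'forall_'forall_implyP ra /'forall_'forall_forallP rt].
  move=> /eqP r1 /'forall_'forall_forallP rc.
  have letr : transitive le.
    by move=> y x z xy yz; have /implyP := rt x y z; apply; rewrite xy.
  have leas : antisymmetric le by move=> x y xy; apply/eqP/ra.
  split; first split=> //.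
    move=> v x y vx vy; have [<-|nvx] := eqVneq v x; first by rewrite vy.
    have [<-|nvy] := eqVneq v y; first by rewrite vx orbT.
    by have /implyP := rc v x y; apply; rewrite /poset_lt nvx nvy vx vy.
  have /card1P[r rP] : #|[pred x | is_maximal le x]| == 1%N by rewrite r1.
  exists r => x.
  (* Among the elements above [x], one with the fewest elements strictly above it is maximal, hence
     equal to [r] by uniqueness. *)
  pose up u := #|[set v | poset_lt le u v]|.
  case: (arg_minnP up (rr x : (fun u => le x u) x)) => a xa amin.
  suff : a \in [pred x | is_maximal le x] by rewrite rP => /eqP <-.
  rewrite inE; apply/forallP => z; apply/negP => az.
  have /andP[naz laz] := az.
  have := amin z (letr _ _ _ xa laz); rewrite leqNgt => /negP; apply.
  apply/proper_card/properP; split.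
    apply/subsetP => v; rewrite !inE => /andP[nzv zv].
    rewrite /poset_lt (letr _ _ _ laz zv) andbT; apply/eqP => eav; subst v.
    by case/eqP: naz; apply: leas; rewrite laz.
  by exists z; rewrite inE // /poset_lt eqxx.
- case=> -[rr ra rt rc] [r rP]; apply/and3P; split.
  + apply/and3P; split.
    * exact/forallP.
    * by apply/'forall_'forall_implyP => x y /ra ->.
    * by apply/'forall_'forall_forallP => x y z; apply/implyP => /andP[]; exact: rt.
  + rewrite -(card1 r); apply/eqP/eq_card => x; rewrite !inE.
    apply/forallP/eqP => [/(_ r)|-> y].
      by rewrite /poset_lt rP andbT negbK => /eqP.
    by apply/negP => /andP[/eqP ne ry]; apply/ne/ra; rewrite ry rP.
  + apply/'forall_'forall_forallP => v x y; apply/implyP.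
    by case/andP=> /andP[_ vx] /andP[_ vy]; exact: rc vx vy.
Qed.

Lemma rooted_forest_poset (T : finType) (le : rel T) :
  rooted_tree le -> forest_poset le.
Proof. by case/rooted_treeP. Qed.

Lemma vertex_le_rooted (t : rtree) : rooted_tree (@vertex_le t).
Proof. exact: valP (repr t). Qed.

Lemma rtree_iso_eq (s t : rtree) :
  poset_iso (@vertex_le s) (@vertex_le t) -> s = t.
Proof.
move=> iso; rewrite -[s]reprK -[t]reprK.
by apply/eqmodP/asboolP.
Qed.

Lemma tree_of_iso (T U : finType) (le : rel T) (le' : rel U) :
  rooted_tree le -> poset_iso le le' -> tree_of le = tree_of le'.
Proof.
move=> rt iso; apply: rtree_iso_eq.
apply: poset_iso_trans (poset_iso_sym (tree_ofP rt)) _.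
apply: (poset_iso_trans iso); apply: tree_ofP.
exact: poset_iso_rooted iso rt.
Qed.

Lemma tree_of_vertex (t : rtree) : tree_of (@vertex_le t) = t.
Proof.
by apply/esym/rtree_iso_eq/tree_ofP/vertex_le_rooted.
Qed.

Lemma induced_iso (S T : finType) (le' : rel S) (le : rel T) (f : S -> T)
    (A : {set T}) :
  injective f -> (forall x y, le' x y = le (f x) (f y)) ->
  f @: setT = A -> poset_iso le' (induced_le le (C := A)).
Proof.
move=> finj fle fA.
have fin x : f x \in A by rewrite -fA imset_f.
exists (fun x => Sub (f x) (fin x) : {y | y \in A}); last by move=> x y; rewrite fle.
apply: inj_card_bij => [x y [/finj]//|].
by rewrite card_sig -cardsT -(card_imset _ finj) fA; apply/subset_leq_card/subsetP.
Qed.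

Lemma tree_of_induced (S T : finType) (le' : rel S) (le : rel T) (f : S -> T)
    (A : {set S}) :
  injective f -> (forall x y, le' x y = le (f x) (f y)) ->
  rooted_tree (induced_le le' (C := A)) ->
  tree_of (induced_le le (C := f @: A)) = tree_of (induced_le le' (C := A)).
Proof.
move=> finj fle rt; apply/esym/tree_of_iso => //.
apply: (@induced_iso _ _ _ _ (fun x => f (val x))) => [x y /finj /val_inj//|x y|].
  exact: fle.
apply/setP => y; apply/imsetP/imsetP => [[x _ ->]|[x xA ->]].
  by exists (val x) => //; exact: valP.
by exists (Sub x xA).
Qed.

Section ForestOf.
Variables (T : finType) (le : rel T).

Definition down (A : {set T}) (v : T) : {set T} := [set y in A | le y v].

Definition maxs (A : {set T}) : {set T} :=
  [set v in A | [forall w in A, le v w ==> (w == v)]].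

(** In a forest poset distinct maximal elements of [A] have disjoint downsets, so this monomial is
    the forest of the connected components of [A]. *)
Definition forest_of (A : {set T}) : forest :=
  \big[mmul/mone]_(v in maxs A) ucm (tree_of (induced_le le (C := down A v))).

Definition upset (A U : {set T}) : bool :=
  (U \subset A) && [forall x in U, forall y in A, le x y ==> (y \in U)].

(* This is the coproduct of [forest_of le A], see [coproduct_treeE]. *)
Definition upset_sum (K : fieldType) (A : {set T}) : HK2 K :=
  \sum_(U : {set T} | upset A U) << (forest_of (A :\: U), forest_of U) >>.

Lemma upsetP (A U : {set T}) :
  reflect (U \subset A /\ forall x y, x \in U -> y \in A -> le x y -> y \in U)
          (upset A U).
Proof.
apply: (iffP andP) => -[UA]; last first.
  move=> H; split => //; apply/forall_inP => x xU; apply/forall_inP => y yA.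
  by apply/implyP; exact: H.
move=> /forall_inP H; split=> // x y xU yA.
by have /forall_inP/(_ y yA)/implyP := H x xU.
Qed.

Lemma maxsP (A : {set T}) v :
  reflect (v \in A /\ forall w, w \in A -> le v w -> w = v) (v \in maxs A).
Proof.
rewrite inE; apply: (iffP andP) => -[vA]; last first.
  move=> H; split=> //; apply/forall_inP => w wA.
  by apply/implyP => /(H _ wA) ->.
by move=> /forall_inP H; split=> // w wA /(implyP (H w wA))/eqP.
Qed.

Lemma down_rooted (A : {set T}) v : forest_poset le -> v \in A ->
  rooted_tree (induced_le le (C := down A v)).
Proof.
move=> [rr ra rt rc] vA; apply/rooted_treeP; split.
  split.
  - by move=> x; exact: rr.
  - by move=> x y /ra /val_inj.
  - by move=> y x z; exact: rt.
  - by move=> u x y; exact: rc.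
have vD : v \in down A v by rewrite inE vA rr.
exists (Sub v vD) => -[x xD].
by have := xD; rewrite [in X in X -> _]inE => /andP[].
Qed.

Lemma maxs_above (A : {set T}) x : forest_poset le -> x \in A ->
  exists2 v, v \in maxs A & le x v.
Proof.
move=> [rr ra rt rc] xA; pose up u := #|down A u|.
case: (@arg_maxnP _ x (fun u => (u \in A) && le x u) up); first by rewrite xA rr.
move=> a /andP[aA xa] amax.
exists a => //; apply/maxsP; split=> // w wA aw; apply/eqP/negPn/negP => nwa.
have := amax w; rewrite wA (rt _ _ _ xa aw) => /(_ isT); rewrite /geq /=.
rewrite leqNgt => /negP; apply; apply/proper_card/properP; split.
  by apply/subsetP => y; rewrite !inE => /andP[-> ya]; exact: rt ya aw.
exists w; rewrite !inE wA ?rr //=; apply: contra nwa => wa.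
by apply/eqP/ra; rewrite wa.
Qed.

End ForestOf.

Lemma imset_diff (S T : finType) (f : S -> T) (A B : {set S}) :
  injective f -> f @: (A :\: B) = f @: A :\: f @: B.
Proof.
move=> finj; apply/setP => y; rewrite inE; apply/imsetP/andP.
  by case=> x; rewrite inE => /andP[xB xA] ->; rewrite !mem_imset.
by case=> yB /imsetP[x xA ?]; subst y; exists x; rewrite // inE xA -(mem_imset _ _ finj) yB.
Qed.

(** * Invariance under order embeddings *)

Section Embedding.
Variables (S T : finType) (le' : rel S) (le : rel T) (f : S -> T).
Hypotheses (finj : injective f) (fle : forall x y, le' x y = le (f x) (f y)).
Hypothesis fp : forest_poset le'.

Lemma down_imset (A : {set S}) v : down le (f @: A) (f v) = f @: down le' A v.
Proof.
apply/setP => y; rewrite inE; apply/andP/imsetP => [[/imsetP[x xA ->]]|[x]].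
  by rewrite -fle => xv; exists x; rewrite ?inE ?xA.
by rewrite inE => /andP[xA xv] ->; rewrite imset_f // -fle.
Qed.

Lemma maxs_imset (A : {set S}) : maxs le (f @: A) = f @: maxs le' A.
Proof.
apply/setP => y; apply/maxsP/imsetP => [[/imsetP[x xA ->] H]|[x /maxsP[xA H] ->]].
  exists x => //; apply/maxsP; split=> // w wA xw; apply: finj.
  by apply: H; rewrite ?imset_f // -fle.
split; first exact: imset_f.
by move=> _ /imsetP[w wA ->]; rewrite -fle => /(H _ wA) ->.
Qed.

Lemma forest_of_imset (A : {set S}) :
  forest_of le (f @: A) = forest_of le' A.
Proof.
rewrite /forest_of maxs_imset big_imset /=; last by move=> x y _ _ /finj.
apply: eq_bigr => v /maxsP[vA _]; rewrite down_imset (tree_of_induced finj fle) //.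
exact: down_rooted.
Qed.

(** Upsets and their forests depend on the order alone; direct and inverse images match the upsets
    of [A] with those of [f @: A]. This moves the sum between the vertex type of a branch and that
    of a larger tree. *)
Lemma upset_sum_imset K (A : {set S}) :
  upset_sum le K (f @: A) = upset_sum le' K A.
Proof.
rewrite /upset_sum (reindex_onto (fun U : {set S} => f @: U) (fun U => f @^-1: U)) /=.
  apply: eq_big => [U|U _]; last by rewrite -(imset_diff _ _ finj) 2!forest_of_imset.
  have -> : f @^-1: (f @: U) = U by apply/setP => x; rewrite inE mem_imset.
  rewrite eqxx andbT; apply/upsetP/upsetP => -[UA H]; split.
  - apply/subsetP => x xU; have /(subsetP UA) : f x \in f @: U by rewrite imset_f.
    by rewrite mem_imset.
  - move=> x y xU yA; rewrite fle => xy.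
    by have := H (f x) (f y); rewrite !mem_imset //; exact.
  - exact: imsetS.
  - move=> _ _ /imsetP[x xU ->] /imsetP[y yA ->]; rewrite -fle mem_imset //.
    exact: H.
move=> U /upsetP[/subsetP UA _]; apply/setP => y; apply/imsetP/idP => [[x]|yU].
  by rewrite inE => ? ->.
by have /imsetP[x xA ?] := UA _ yU; subst y; exists x; rewrite ?inE.
Qed.

End Embedding.

Lemma malgUM (K : fieldType) (M : conomType) (a b : M) :
  << mmul a b >> = << a >> * << b >> :> {malg K[M]}.
Proof. by rewrite malgM_def fgmulUU mulr1. Qed.

Lemma malgU1 (K : fieldType) (M : conomType) : << mone >> = 1 :> {malg K[M]}.
Proof. by []. Qed.

Lemma pair_mmul1 (M N : conomType) (m : M) (n : N) :
  mmul ((m, mone) : M * N) (mone, n) = (m, n).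
Proof. by rewrite /mmul /= /pair_mmul /= mulm1 mul1m. Qed.

Lemma malgU_prod (K : fieldType) (M : conomType) (I : Type) (s : seq I)
    (P : pred I) (F : I -> M) :
  << \big[mmul/mone]_(i <- s | P i) F i >> = \prod_(i <- s | P i) << F i >>
    :> {malg K[M]}.
Proof. exact: (big_morph (fun m => << m >>) (@malgUM K M) (malgU1 K M)). Qed.

Lemma big_disjoint_setU (R : Type) (idx : R) (op : Monoid.com_law idx)
    (I : finType) (A B : {set I}) (F : I -> R) : [disjoint A & B] ->
  \big[op/idx]_(i in A :|: B) F i =
    op (\big[op/idx]_(i in A) F i) (\big[op/idx]_(i in B) F i).
Proof.
by move=> dAB; rewrite -bigU //; apply: eq_bigl => i; rewrite in_setU.
Qed.

(** * Multiplicativity on unrelated unions *)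

Section Union.
Variables (T : finType) (le : rel T).

Definition unrelated (A B : {set T}) : Prop :=
  forall x y, x \in A -> y \in B -> ~~ le x y /\ ~~ le y x.

Lemma unrelatedC (A B : {set T}) : unrelated A B -> unrelated B A.
Proof. by move=> AB x y xB yA; have [] := AB y x yA xB. Qed.

Lemma unrelatedS (A B A' B' : {set T}) : A' \subset A -> B' \subset B ->
  unrelated A B -> unrelated A' B'.
Proof. by move=> /subsetP sA /subsetP sB AB x y /sA xA /sB; exact: AB. Qed.

Lemma down_unrelated (A B : {set T}) v : unrelated A B -> v \in A ->
  down le (A :|: B) v = down le A v.
Proof.
move=> AB vA; apply/setP => y; rewrite !inE.
by case yB: (y \in B); rewrite ?orbF // (negbTE (AB _ _ vA yB).2) !andbF.
Qed.

Lemma maxs_unrelated (A B : {set T}) : unrelated A B ->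
  maxs le (A :|: B) = maxs le A :|: maxs le B.
Proof.
move=> AB; apply/setP => v; rewrite in_setU; apply/maxsP/orP.
  case; rewrite in_setU => /orP[vA|vB] H; [left|right]; apply/maxsP; split => // w wAB;
   by apply: H; rewrite in_setU wAB ?orbT.
case=> /maxsP[vAB H]; rewrite in_setU vAB ?orbT; split=> // w; rewrite in_setU.
  by case/orP => [wA|wB]; [exact: H|rewrite (negbTE (AB _ _ vAB wB).1)].
by case/orP => [wA|wB]; [rewrite (negbTE (AB _ _ wA vAB).2)|exact: H].
Qed.

Hypothesis lexx : reflexive le.

Lemma unrelated_disjoint (A B : {set T}) : unrelated A B -> [disjoint A & B].
Proof.
move=> AB; rewrite disjoint_subset; apply/subsetP => x xA; rewrite inE.
by apply/negP => xB; have [] := AB x x xA xB; rewrite lexx.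
Qed.

Lemma forest_of0 : forest_of le set0 = mone.
Proof. by rewrite /forest_of big1 // => v; rewrite inE in_set0. Qed.

Lemma forest_ofU (A B : {set T}) : unrelated A B ->
  forest_of le (A :|: B) = mmul (forest_of le A) (forest_of le B).
Proof.
move=> AB; have dM : [disjoint maxs le A & maxs le B].
  by apply: disjointW (unrelated_disjoint AB); apply/subsetP => x /maxsP[].
rewrite {1}/forest_of maxs_unrelated // (big_disjoint_setU _ _ dM).
have -> : \big[mmul/mone]_(v in maxs le A)
    ucm (tree_of (induced_le le (C := down le (A :|: B) v))) = forest_of le A.
  by apply: eq_bigr => v /maxsP[vA _]; rewrite down_unrelated.
have -> : \big[mmul/mone]_(v in maxs le B)
    ucm (tree_of (induced_le le (C := down le (A :|: B) v))) = forest_of le B.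
  apply: eq_bigr => v /maxsP[vB _]; rewrite setUC down_unrelated //.
  exact: unrelatedC.
by [].
Qed.

Variable K : fieldType.

Lemma upset_sum0 : upset_sum le K set0 = 1.
Proof.
rewrite /upset_sum (big_pred1 set0); first by rewrite set0D forest_of0.
move=> U; apply/upsetP/eqP => [[]|->]; first by rewrite subset0 => /eqP.
by split=> // x y; rewrite inE.
Qed.

Lemma upset_unrelated (A B U V : {set T}) : unrelated A B -> U \subset A -> V \subset B ->
  upset le (A :|: B) (U :|: V) = upset le A U && upset le B V.
Proof.
move=> AB UA VB; apply/upsetP/andP => [[_ H]|[/upsetP[_ HU] /upsetP[_ HV]]].
  split; apply/upsetP; split=> // x y xU yA xy.
    have := H x y; rewrite !in_setU xU yA => /(_ isT isT xy) /orP[//|].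
    by move=> /(subsetP VB) yB; case: (AB x y (subsetP UA _ xU) yB); rewrite xy.
  have := H x y; rewrite !in_setU xU yA !orbT => /(_ isT isT xy) /orP[|//].
  by move=> /(subsetP UA) yB; case: (AB y x yB (subsetP VB _ xU)); rewrite xy.
split; first exact: setUSS.
move=> x y; rewrite !in_setU => /orP[xU|xV] /orP[yA|yB] xy.
- by rewrite (HU x y).
- by case: (AB x y (subsetP UA _ xU) yB); rewrite xy.
- by case: (AB y x yA (subsetP VB _ xV)); rewrite xy.
- by rewrite (HV x y) ?orbT.
Qed.

(** An upset of the union is a pair of upsets, recovered by intersecting with [A] and [B], and
    [forest_of] is multiplicative in both tensor factors. *)
Lemma upset_sumU (A B : {set T}) : unrelated A B ->
  upset_sum le K (A :|: B) = upset_sum le K A * upset_sum le K B.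
Proof.
move=> AB; have dAB := unrelated_disjoint AB.
have dis x : x \in A -> x \in B -> False.
  by move=> xA; rewrite (disjointFr dAB xA).
rewrite /upset_sum big_distrlr /= pair_big_dep /=.
rewrite (reindex_onto (fun p : {set T} * {set T} => p.1 :|: p.2)
   (fun W => (W :&: A, W :&: B))) /=; last first.
  by move=> W /upsetP[/setIidPl WAB _]; rewrite -setIUr.
apply: eq_big => [[U V]|[U V]] /=.
  apply/andP/andP => [[UV /eqP[UA VB]]|[HU HV]].
    have sU : U \subset A by rewrite -UA subsetIr.
    have sV : V \subset B by rewrite -VB subsetIr.
    by move: UV; rewrite upset_unrelated // => /andP[].
  have [UA _] := upsetP _ _ _ HU; have [VB _] := upsetP _ _ _ HV.
  rewrite upset_unrelated // HU HV; split=> //; apply/eqP; congr pair;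
   rewrite setIUl.
    rewrite (setIidPl UA) (_ : V :&: A = set0) ?setU0 //.
    by apply/setP => x; rewrite !inE; apply/negP => /andP[/(subsetP VB) /dis].
  rewrite (setIidPl VB) (_ : U :&: B = set0) ?set0U //.
  by apply/setP => x; rewrite !inE; apply/negP => /andP[/(subsetP UA) /dis].
case/andP=> /upsetP[sUV _] /eqP[UA VB].
have sU : U \subset A by rewrite -UA subsetIr.
have sV : V \subset B by rewrite -VB subsetIr.
rewrite -malgUM; congr (mkmalgU _ 1); congr pair => /=; last first.
  by rewrite forest_ofU //; exact: unrelatedS AB.
rewrite -forest_ofU; last by apply: unrelatedS AB; exact: subsetDl.
congr forest_of; apply/setP => x; rewrite !inE negb_or.
case xU: (x \in U); case xV: (x \in V); rewrite /= ?andbF ?andbT //.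
- apply/esym/negP => xB; exact: dis (subsetP sU _ xU) xB.
- rewrite orbF; apply/esym/negP => xA; exact: dis xA (subsetP sV _ xV).
Qed.

End Union.

Section Family.
Variables (T I : finType) (le : rel T) (lexx : reflexive le).
Variables (A : I -> {set T}).
Hypothesis Aunrel : forall i j, i != j -> unrelated le (A i) (A j).

Lemma unrelated_bigcup (i : I) (r : seq I) : i \notin r ->
  unrelated le (A i) (\bigcup_(j <- r) A j).
Proof.
elim: r => [|j r IH]; first by rewrite big_nil => _ x y; rewrite inE.
rewrite in_cons negb_or big_cons => /andP[ij ir] x y xA; rewrite in_setU.
by case/orP => [yA|yr]; [exact: (Aunrel ij xA yA)|exact: (IH ir x y xA yr)].
Qed.

Lemma upset_sum_bigcup (K : fieldType) (r : seq I) : uniq r ->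
  upset_sum le K (\bigcup_(i <- r) A i) = \prod_(i <- r) upset_sum le K (A i).
Proof.
elim: r => [|i r IH] /=; first by rewrite !big_nil upset_sum0.
case/andP=> ir ur; rewrite !big_cons upset_sumU ?IH //; exact: unrelated_bigcup.
Qed.

End Family.

(** * Monoid algebras *)

Lemma malgU_mulC (K : fieldType) (M : conomType) (c : K) (m : M) :
  << c *g m >> = c%:MP * << m >>.
Proof. by rewrite mul_malgC; apply/malgP => k; rewrite mcoeffZ !mcoeffU mulr_natr. Qed.

Section MalgMap.
Variables (K : fieldType) (M L : conomType) (h : M -> L).

(** The linear extension of an arbitrary map [h] of monomials. Both tensor embeddings, [Bplus] and
    its action on the right tensor factor have this shape. *)
Definition malg_map : {malg K[M]} -> {malg K[L]} :=
  mmap (@malgC L K) (fun m => << h m >>).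
HB.instance Definition _ :=
  GRing.Additive.copy malg_map (mmap (@malgC L K) (fun m => << h m >>)).

Lemma malg_mapD : {morph malg_map : a b / a + b}. Proof. exact: raddfD. Qed.
Lemma malg_map0 : malg_map 0 = 0. Proof. exact: raddf0. Qed.

Lemma malg_mapU c m : malg_map << c *g m >> = << c *g h m >>.
Proof. by rewrite /malg_map mmapU -malgU_mulC. Qed.

Lemma malg_mapE a : malg_map a = \sum_(m <- msupp a) << a@_m *g h m >>.
Proof. by apply: eq_bigr => m _; rewrite -malgU_mulC. Qed.

Lemma malg_map_sum (I : Type) (r : seq I) (P : pred I) (F : I -> {malg K[M]}) :
  malg_map (\sum_(i <- r | P i) F i) = \sum_(i <- r | P i) malg_map (F i).
Proof. exact: (big_morph _ malg_mapD malg_map0). Qed.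

End MalgMap.

Section MalgTensor.
Variables (K : fieldType) (M N L : conomType) (i : M -> L) (j : N -> L).

(** For [i f = (f, mone)] and [j g = (mone, g)] the left side is [tensor a b], which thereby becomes
    a product in the tensor square. For [i = j = h] with [h] multiplicative, it gives
    multiplicativity of [malg_map h]. *)
Lemma malg_tensor_sum (a : {malg K[M]}) (b : {malg K[N]}) :
  \sum_(f <- msupp a) \sum_(g <- msupp b) << a@_f * b@_g *g mmul (i f) (j g) >>
    = malg_map i a * malg_map j b.
Proof.
rewrite !malg_mapE mulr_suml; apply: eq_bigr => f _; rewrite mulr_sumr.
by apply: eq_bigr => g _; rewrite malgM_def fgmulUU.
Qed.

Variables (beta : N -> N) (gamma : L -> L).
Hypothesis gammaE : forall m n, gamma (mmul (i m) (j n)) = mmul (i m) (j (beta n)).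

Lemma malg_map_tensor (a : {malg K[M]}) (b : {malg K[N]}) :
  malg_map gamma (malg_map i a * malg_map j b) =
  malg_map i a * malg_map j (malg_map beta b).
Proof.
rewrite -malg_tensor_sum (malg_mapE beta) (malg_map_sum j) malg_map_sum.
rewrite (malg_mapE i) mulr_suml; apply: eq_bigr => f _.
rewrite malg_map_sum mulr_sumr; apply: eq_bigr => g _.
by rewrite !malg_mapU malgM_def fgmulUU gammaE.
Qed.

End MalgTensor.

Section MalgMapMorphism.
Variables (K : fieldType) (M L : conomType) (h : M -> L).
Hypotheses (h1 : h mone = mone) (hM : forall m n, h (mmul m n) = mmul (h m) (h n)).

Lemma malg_map1 : malg_map h 1 = 1 :> {malg K[L]}.
Proof. by rewrite -(malgU1 K M) malg_mapU h1. Qed.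

Lemma malg_mapM : {morph @malg_map K M L h : a b / a * b}.
Proof.
move=> a b; rewrite -malg_tensor_sum malgME malg_map_sum; apply: eq_bigr => f _.
by rewrite malg_map_sum; apply: eq_bigr => g _; rewrite malg_mapU hM.
Qed.

End MalgMapMorphism.

(** * Algebra morphisms determined by their values on generators *)

Section CmonomMorphism.
Variables (I : choiceType) (S : comNzRingType) (d : I -> S).

Definition cmonom_eval (m : {cmonom I}) : S := \prod_(t <- finsupp m) d t ^+ m t.

(** The additional factors have exponent 0. A common index set lets two monomials and their product
    be compared factor by factor. *)
Lemma cmonom_evalE (D : {fset I}) (m : {cmonom I}) : (finsupp m `<=` D)%fset ->
  cmonom_eval m = \prod_(t <- D) d t ^+ m t.
Proof.
move=> le; rewrite /cmonom_eval (big_fset_incl _ le) //.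
by move=> t _; rewrite -cmE_eq0 => /eqP ->.
Qed.

Lemma cmonom_eval_mmorphism : mmorphism cmonom_eval.
Proof.
split=> [m n|]; last by rewrite /cmonom_eval mdom1 big_seq_fset0.
rewrite (@cmonom_evalE (finsupp m `|` finsupp n)%fset m) ?fsubsetUl //.
rewrite (@cmonom_evalE (finsupp m `|` finsupp n)%fset n) ?fsubsetUr //.
rewrite (@cmonom_evalE (finsupp m `|` finsupp n)%fset); last by rewrite mdomD.
by rewrite -big_split; apply: eq_bigr => t _; rewrite cmM exprD.
Qed.
HB.instance Definition _ :=
  isMultiplicative.Build {cmonom I} S cmonom_eval cmonom_eval_mmorphism.

End CmonomMorphism.

Section MalgEval.
Variables (K : fieldType) (I : choiceType) (L : conomType) (d : I -> {malg K[L]}).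

(** The body copies that of [coproduct] with arbitrary values [d] on the generators, so that
    [coproductE] holds by computation. *)
Definition malg_eval (a : {malg K[cmonom I]}) : {malg K[L]} :=
  \sum_(f <- msupp a) a@_f *: \prod_(t <- finsupp f) d t ^+ f t.

Lemma malg_evalE : malg_eval =1 mmap (@malgC L K) (cmonom_eval d).
Proof. by move=> a; apply: eq_bigr => f _; rewrite mul_malgC. Qed.

Lemma malg_eval_multiplicative :
  [/\ malg_eval 1 = 1, {morph malg_eval : a b / a * b} &
      {morph malg_eval : a b / a + b}].
Proof.
split=> [|a b|a b]; rewrite !malg_evalE; [exact: rmorph1|exact: rmorphM|exact: rmorphD].
Qed.

End MalgEval.

(** * Admissible cuts and upsets *)

Section Cuts.
Variables (T : finType) (le : rel T) (r : T).
Hypotheses (fp : forest_poset le) (lex : forall x, le x r).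

Let lexx : reflexive le. Proof. by case: fp. Qed.
Let leas : antisymmetric le. Proof. by case: fp. Qed.
Let letr : transitive le. Proof. by case: fp. Qed.
Let lech v x y : le v x -> le v y -> le x y || le y x.
Proof. by case: fp => _ _ _; exact. Qed.

Lemma tree_edgeP u v :
  reflect [/\ v <> u, le v u & forall z, le v z -> le z u -> z = v \/ z = u]
          (tree_edge le u v).
Proof.
apply: (iffP andP) => [[/andP[/eqP vu lvu] /forallP H]|[vu lvu H]].
  split=> // z vz zu; have := H z; rewrite /poset_lt vz zu !andbT.
  by rewrite negb_and !negbK => /orP[/eqP ->|/eqP ->]; [left|right].
rewrite /poset_lt lvu andbT; split; first exact/eqP.
apply/forallP => z; apply/negP => /andP[/andP[/eqP vz lvz] /andP[/eqP zu lzu]].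
by case: (H z lvz lzu) => ?; [case: vz|case: zu].
Qed.

Lemma is_maximalP u : reflect (u = r) (is_maximal le u).
Proof.
apply: (iffP forallP) => [/(_ r)|-> y].
  by rewrite /poset_lt lex andbT negbK => /eqP.
by apply/negP => /andP[/eqP ry lry]; apply/ry/leas; rewrite lry lex.
Qed.

(** The parent is found as an element with the smallest downset among those strictly above [y] and
    below or equal to [x]. *)
Lemma parent_exists x y : le y x -> y <> x -> exists2 u, tree_edge le u y & le u x.
Proof.
move=> yx nyx; pose dn z := #|[set w | le w z]|.
case: (@arg_minnP _ x (fun z => [&& y != z, le y z & le z x]) dn).
  by rewrite yx lexx !andbT; apply/eqP.
move=> u /and3P[/eqP yu lyu ux] umin; exists u => //; apply/tree_edgeP; split=> // z yz zu.
have [->|/eqP nzy] := eqVneq z y; first by left.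
have [->|/eqP nzu] := eqVneq z u; first by right.
have nyz : y != z by rewrite eq_sym; apply/eqP.
have := umin z; rewrite nyz yz (letr zu ux) leqNgt => /(_ isT)/negP; case.
apply/proper_card/properP; split.
  by apply/subsetP => w; rewrite !inE => /letr; exact.
exists u; rewrite !inE ?lexx //; apply/negP => uz; apply: nzu.
by apply: leas; rewrite zu.
Qed.

(** The upset of [v] is a chain, so [u] and [w] are comparable, and nothing lies strictly between
    [v] and [u]. *)
Lemma parent_le u v w : tree_edge le u v -> le v w -> w <> v -> le u w.
Proof.
move=> /tree_edgeP[vu lvu H] vw nwv; case/orP: (lech lvu vw) => // wu.
by case: (H w vw wu) => [//|->]; rewrite lexx.
Qed.

Lemma parent_inj u u' v : tree_edge le u v -> tree_edge le u' v -> u = u'.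
Proof.
move=> uv u'v; have /tree_edgeP[nvu vu _] := uv; have /tree_edgeP[nvu' vu' _] := u'v.
by apply: leas; rewrite (parent_le uv vu') ?(parent_le u'v vu) //; apply/nesym.
Qed.

(** Induction descending from [x] along parent edges; the measure is the number of elements above
    [y]. *)
Lemma up_ind (P : T -> Prop) x : P x ->
  (forall u y, tree_edge le u y -> le y x -> le u x -> y <> x -> P u -> P y) ->
  forall y, le y x -> P y.
Proof.
move=> Px step y; have [n] := ubnP #|[set w | le y w]|.
elim: n y => // n IH y; rewrite ltnS => yn yx.
have [->//|/eqP nyx] := eqVneq y x.
have [u uy ux] := parent_exists yx nyx; apply: (step u) => //; apply: IH => //.
apply: leq_trans yn; apply/proper_card/properP.
have /tree_edgeP[nyu yu _] := uy; split.
  by apply/subsetP => w; rewrite !inE; exact: letr.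
exists y; rewrite !inE ?lexx //; apply/negP => uy'; apply: nyu.
by apply: leas; rewrite yu.
Qed.

Lemma down_path x y : le y x -> exists2 s, path (tree_edge le) x s & last x s = y.
Proof.
move: y; apply: up_ind => [|u y uy _ ux _ [s ps us]]; first by exists [::].
by exists (rcons s y); rewrite ?last_rcons // rcons_path ps us.
Qed.

Lemma leaf_below x : exists2 l, is_leaf le l & le l x.
Proof.
pose dn z := #|[set w | le w z]|.
case: (@arg_minnP _ x (fun z => le z x) dn) => // l lx lmin; exists l => //.
apply/forallP => w; apply/negP => /tree_edgeP[nwl wl _].
have := lmin w (letr wl lx); rewrite leqNgt => /negP; apply.
apply/proper_card/properP; split.
  by apply/subsetP => z; rewrite !inE => /letr; exact.
exists l; rewrite !inE ?lexx //; apply/negP => lw; apply: nwl.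
by apply: leas; rewrite wl.
Qed.

Section Residual.
Variable c : {set T * T}.
Hypothesis cE : c \subset tree_edges le.

Lemma cut_edge e : e \in c -> tree_edge le e.1 e.2.
Proof. by move=> /(subsetP cE); rewrite inE. Qed.

Lemma residual_sym : connect_sym (residual le c).
Proof. by apply: sym_connect_sym => u v; rewrite /residual orbC. Qed.

(** The downset of the lower end [e.2] of a cut edge is closed under residual adjacency: the only
    tree edge leaving it joins [e.2] to its parent, and that edge is [e] itself. *)
Lemma residual_connect_le e x y : e \in c -> connect (residual le c) x y ->
  le x e.2 = le y e.2.
Proof.
move=> ec; apply: (closed_connect (a := [pred x | le x e.2])).
apply: (intro_closed residual_sym) => a b; rewrite !inE => /orP[/andP[ab _]|/andP[ba bac]].
  by have /tree_edgeP[_ lba _] := ab; exact: letr.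
move=> ae; apply: (parent_le ba ae) => ea.
have eb : e.1 = b by apply: parent_inj ba; rewrite -ea; exact: cut_edge.
by case/negP: bac; rewrite -ea -eb -surjective_pairing.
Qed.

(** Climb from [y] to [x] through parents: each edge used has its lower end between [y] and [x] and
    different from [x], so the hypothesis keeps it out of [c]. *)
Lemma residual_connect_up x y :
  (forall e, e \in c -> le y e.2 -> le e.2 x -> e.2 = x) ->
  le y x -> connect (residual le c) y x.
Proof.
move=> H yx; elim/up_ind: y / yx H => [_|u y uy yx ux nyx IH H].
  exact: connect0.
have /tree_edgeP[_ yu _] := uy.
apply: connect_trans (connect1 _) (IH _); last first.
  by move=> e ec ue; apply: H => //; exact: letr ue.
rewrite /residual uy orbC /=; apply/orP; left; apply/negP => uyc.
by apply: nyx; exact: (H _ uyc).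
Qed.

Lemma cut_below_root e : e \in c -> ~~ le r e.2.
Proof.
move=> /cut_edge/tree_edgeP[ne le21 _]; apply/negP => re; apply: ne.
have er : e.2 = r by apply: leas; rewrite re lex.
by rewrite er; apply: leas; rewrite lex -er le21.
Qed.

Lemma root_component_r : root_component le c = component le c r.
Proof.
apply/setP => y; rewrite inE; apply/existsP/idP => [[r'] /andP[/is_maximalP -> //]|yr].
by exists r; rewrite yr andbT; apply/is_maximalP.
Qed.

(** Cutting detaches exactly the downsets of the lower ends of the cut edges. This makes the root
    component visibly an upset. *)
Lemma root_componentP y :
  reflect (forall e, e \in c -> ~~ le y e.2) (y \in root_component le c).
Proof.
rewrite root_component_r inE; apply: (iffP idP) => [ry e ec|H].
  by rewrite -(residual_connect_le ec ry) cut_below_root.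
rewrite residual_sym; apply: residual_connect_up (lex y) => e ec ye.
by rewrite (negbTE (H e ec)) in ye.
Qed.

Lemma eq_component x y : x \in component le c y -> component le c x = component le c y.
Proof.
rewrite inE => yx; apply/setP => z; rewrite !inE; apply/esym.
exact: (same_connect residual_sym yx).
Qed.

End Residual.

(** The inverse of [root_component] in the correspondence between admissible cuts and upsets
    containing the root. *)
Definition cutset (U : {set T}) : {set T * T} :=
  [set e in tree_edges le | (e.1 \in U) && (e.2 \notin U)].

Lemma cutset_edges U : cutset U \subset tree_edges le.
Proof. by apply/subsetP => e; rewrite inE => /andP[]. Qed.

Section UpsetCut.
Variable U : {set T}.
Hypotheses (rU : r \in U) (upU : forall x y, x \in U -> le x y -> y \in U).

Lemma admissible_cutset : admissible le (cutset U).
Proof.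
split; first exact: cutset_edges.
(* A descending path that has left [U] never returns, so the bound is sharpened for the induction:
   at most one cut edge if the path starts in [U], none otherwise. *)
move=> x s _ ps _; apply: (@leq_trans (x \in U)); last by case: (x \in U).
elim: s x ps => //= y s IH x /andP[xy /IH{}IH].
have /tree_edgeP[_ yx _] := xy; rewrite inE /= in_set xy /=.
have [yU|yU] := boolP (y \in U); last first.
  by move: IH; rewrite (negbTE yU) leqn0 andbT => /eqP ->; rewrite addn0.
by rewrite andbF (upU yU yx); rewrite yU in IH.
Qed.

Lemma max_parent v : v \in maxs le (~: U) -> exists2 u, u \in U & tree_edge le u v.
Proof.
move=> /maxsP[vU vmax]; have nvr : v <> r by move=> vr; rewrite inE vr rU in vU.
have [u uv ur] := parent_exists (lex v) nvr; exists u => //.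
apply/negPn/negP => uU; have /tree_edgeP[nvu vu _] := uv.
by apply: nvu; rewrite (vmax u) // inE.
Qed.

Lemma max_in_cutset u v : v \in maxs le (~: U) -> u \in U -> tree_edge le u v ->
  (u, v) \in cutset U.
Proof.
move=> /maxsP[vU _] uU uv; rewrite inE /= uU in_set uv /=.
by rewrite in_setC in vU.
Qed.

Lemma root_component_cutset : root_component le (cutset U) = U.
Proof.
apply/setP => y; apply/(root_componentP (cutset_edges U))/idP => [H|yU e].
  apply/negPn/negP => yU.
  have [|v vmax yv] := maxs_above fp (A := ~: U) (x := y); first by rewrite inE.
  have [u uU uv] := max_parent vmax.
  by have := H _ (max_in_cutset vmax uU uv); rewrite yv.
rewrite inE => /andP[_ /andP[_ eU]]; apply: contra eU; exact: upU.
Qed.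

(** The edge above [v] is cut, so the component stays below [v]; no edge with both ends outside [U]
    is cut, so it contains everything below [v]. *)
Lemma component_cutset v : v \in maxs le (~: U) ->
  component le (cutset U) v = down le (~: U) v.
Proof.
move=> vmax; have /maxsP[vU _] := vmax; have [u uU uv] := max_parent vmax.
have vc := max_in_cutset vmax uU uv; rewrite inE in vU.
apply/setP => y; rewrite [y \in component _ _ _]inE.
apply/idP/setIdP => [vy|[_ yv]].
  have /esym := residual_connect_le (cutset_edges U) vc vy; rewrite /= lexx => yv.
  by split=> //; rewrite inE; apply: contra vU => yU; exact: upU yv.
rewrite residual_sym; apply: residual_connect_up yv.
move=> e ec ye ev; apply/eqP/negPn/negP => /eqP nev; move: ec; rewrite inE.
case/andP; rewrite inE => ee /andP[e1 _]; case/negP: vU; apply: upU e1 _.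
by apply: parent_le ee ev _; apply/nesym.
Qed.

Lemma components_cutset :
  components le (cutset U) :\ root_component le (cutset U)
    = [set down le (~: U) v | v in maxs le (~: U)].
Proof.
apply/setP => C; rewrite in_setD1; apply/andP/imsetP.
  case=> Croot /imsetP[x _ Cx]; subst C.
  have xU : x \in ~: U.
    rewrite inE; apply: contra Croot => xU.
    rewrite root_component_r; apply/eqP/eq_component.
    by rewrite -root_component_r root_component_cutset.
  have [v vmax xv] := maxs_above fp xU; exists v => //.
  rewrite -component_cutset //; apply: eq_component.
  by rewrite component_cutset // !inE xv andbT -in_setC.
case=> v vmax ->; have /maxsP[vU _] := vmax; split; last first.
  by rewrite -component_cutset // imset_f.
rewrite root_component_cutset; apply/eqP => dU; move: vU; rewrite inE -dU.
rewrite !inE lexx andbT (_ : v \in U = false) //; apply/negbTE.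
by move/maxsP: vmax => []; rewrite inE.
Qed.

End UpsetCut.

(** Together with [root_component_cutset] this is the bijection between cuts and upsets.
    Admissibility keeps the upper end of each cut edge in the root component. *)
Lemma upset_root_component c : admissible le c ->
  [/\ r \in root_component le c,
      forall x y, x \in root_component le c -> le x y -> y \in root_component le c &
      cutset (root_component le c) = c].
Proof.
move=> [cE adm]; have rcP := root_componentP cE; split.
- by apply/rcP => e; exact: cut_below_root.
- move=> x y /rcP xc xy; apply/rcP => e /xc; apply: contra; exact: letr.
apply/setP => -[u v]; apply/idP/idP => [|uvc].
  rewrite inE /= in_set => /andP[uv /andP[/= /rcP uU vU]]; apply: contraNT vU => uvc.
  apply/rcP => e ec; apply/negP => ve; have [ev|/eqP nev] := eqVneq e.2 v.
    have eu : e.1 = u by apply: parent_inj uv; rewrite -ev; exact: (cut_edge cE).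
    by case/negP: uvc; rewrite -ev -eu -surjective_pairing.
  by have := uU _ ec; rewrite (parent_le uv ve nev).
have uv := cut_edge cE uvc; rewrite inE /= in_set uv /=; apply/andP; split; last first.
  by apply/negP => /rcP/(_ _ uvc); rewrite lexx.
apply/rcP => -[a b] abc /=; apply/negP => ub; have ab := cut_edge cE abc.
(* If [u] lay below the lower end of a cut edge [(a, b)], the path from [r] through [a], [b], [u],
   [v] down to a leaf [l] would meet the cut twice, in [(a, b)] and in [(u, v)]. *)
have [s1 p1 l1] := down_path (lex a).
have [s2 p2 l2] := down_path ub.
have [l leaf_l lv] := leaf_below v.
have [s3 p3 l3] := down_path lv.
have rmax : is_maximal le r by apply/is_maximalP.
have := adm r (s1 ++ b :: s2 ++ v :: s3) rmax.
rewrite cat_path p1 /= l1 ab /= cat_path p2 /= l2 uv p3 last_cat /= last_cat /= l3.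
move=> /(_ isT leaf_l); rewrite pairmap_cat /= pairmap_cat /= l1 l2.
rewrite count_cat /= count_cat /= abc uvc.
by rewrite !add1n !addnS.
Qed.

End Cuts.

(** * The coproduct of a tree as a sum over upsets *)

Lemma tensorE (K : fieldType) (a b : HK K) :
  tensor a b = malg_map (fun f => (f, mone) : forest * forest) a *
               malg_map (fun f => (mone, f) : forest * forest) b.
Proof.
rewrite -malg_tensor_sum; apply: eq_bigr => f _; apply: eq_bigr => g _.
by rewrite [mmul _ _]pair_mmul1.
Qed.

Section CoproductTree.
Variables (K : fieldType) (T : finType) (le : rel T) (r : T).
Hypotheses (fp : forest_poset le) (lex : forall x, le x r).

Lemma tensorU (a b : forest) : tensor (<< a >> : HK K) << b >> = << (a, b) >>.
Proof.
by rewrite tensorE 2!malg_mapU -malgUM pair_mmul1.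
Qed.

Lemma forest_of_rooted (A : {set T}) : r \in A ->
  forest_of le A = ucm (tree_of (induced_le le (C := A))).
Proof.
have [lexx leas _ _] := fp => rA; rewrite /forest_of (big_pred1 r) => [|v].
  by congr (ucm (tree_of (induced_le le (C := _)))); apply/setP => x; rewrite inE lex andbT.
apply/maxsP/eqP => [[vA H]|->]; first by rewrite (H r).
by split=> // w _ rw; apply: leas; rewrite rw lex.
Qed.

Lemma prod_components (U : {set T}) : r \in U ->
  (forall x y, x \in U -> le x y -> y \in U) ->
  \prod_(C in components le (cutset le U) :\ root_component le (cutset le U))
     tree_gen K (tree_of (induced_le le (C := C))) = << forest_of le (~: U) >>.
Proof.
have [lexx leas _ _] := fp => rU upU; rewrite (components_cutset fp lex) //.
rewrite big_imset /=; first exact/esym/malgU_prod.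
move=> v w /maxsP[vU _] /maxsP[wU _] vw; apply: leas.
have /setIdP[_ ->] : v \in down le (~: U) w.
  by rewrite -vw; apply/setIdP; rewrite lexx.
have /setIdP[_ ->//] : w \in down le (~: U) v.
by rewrite vw; apply/setIdP; rewrite lexx.
Qed.

Lemma cuts_upset_sum :
  << (ucm (tree_of (induced_le le (C := setT))), mone) >> +
  \sum_(c : {set T * T} | `[< admissible le c >])
    tensor (\prod_(C in components le c :\ root_component le c)
              tree_gen K (tree_of (induced_le le (C := C))))
           (tree_gen K (tree_of (induced_le le (C := root_component le c))))
  = upset_sum le K setT.
Proof.
(* The empty upset gives the isolated first term; every other upset contains the greatest element
   [r] and comes from a unique admissible cut. *)
rewrite /upset_sum [RHS](bigD1 set0) /=; last first.
  by apply/upsetP; split=> [|x y]; rewrite ?sub0set // inE.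
rewrite setD0 forest_of0 forest_of_rooted ?inE //; congr (_ + _).
have uP U : upset le setT U && (U != set0) ->
    r \in U /\ (forall x y, x \in U -> le x y -> y \in U).
  case/andP=> /upsetP[_ H] /set0Pn[x xU]; split; first by apply: H (lex x).
  by move=> y z yU; apply: H.
rewrite (reindex_onto (cutset le) (root_component le)) /=; last first.
  by move=> c /asboolP/(upset_root_component fp lex)[].
apply: eq_big => [U|U /andP[/asboolP/(upset_root_component fp lex)[rU upU _] /eqP UE]].
  apply/andP/idP => [[/asboolP/(upset_root_component fp lex)[rU upU _] /eqP UE]|].
    rewrite UE in rU upU; apply/andP; split; last by apply/set0Pn; exists r.
    by apply/upsetP; split=> // x y xU _; exact: upU.
  move=> /uP[rU upU]; rewrite (root_component_cutset fp lex) //; split=> //.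
  by apply/asboolP; apply: admissible_cutset.
rewrite UE in rU upU; rewrite prod_components // UE tensorU setTD.
by rewrite (forest_of_rooted rU).
Qed.

End CoproductTree.

Lemma coproduct_treeE (K : fieldType) (t : rtree) :
  coproduct_tree K t = upset_sum (@vertex_le t) K setT.
Proof.
have /rooted_treeP[fp [r lex]] := vertex_le_rooted t.
have -> : coproduct_tree K t = << (ucm t, mone) >> +
    \sum_(c : {set vertex t * vertex t} | `[< admissible (@vertex_le t) c >])
      tensor (Pcut K c) (Rcut K c).
  by rewrite /coproduct_tree -(malgU1 K forest) tensorU.
have {1}-> : t = tree_of (induced_le (@vertex_le t) (C := setT)).
  rewrite -[LHS]tree_of_vertex; apply/tree_of_iso; first exact: vertex_le_rooted.
  by apply: (@induced_iso _ _ _ _ id) => //; rewrite imset_id.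
exact: (cuts_upset_sum K fp lex).
Qed.

(** * Grafting *)

Lemma count_forest_seq (f : forest) (t : rtree) : count_mem t (forest_seq f) = f t.
Proof.
rewrite /forest_seq count_flatten -map_comp sumnE big_map.
have [tf|tf] := boolP (t \in finsupp f).
  rewrite (bigD1_seq t) ?fset_uniq //= count_nseq /= eqxx mul1n big1 ?addn0 // => u nut.
  by rewrite /= count_nseq /= (negbTE nut).
rewrite big_seq big1 => [|u uf]; first by move: tf; rewrite -cmE_eq0 => /eqP ->.
rewrite /= count_nseq /=; have [ut|//] := eqVneq u t.
by rewrite ut (negbTE tf) in uf.
Qed.

Lemma cmonom_prodE (I : choiceType) (J : Type) (r : seq J) (P : pred J)
    (F : J -> {cmonom I}) (t : I) :
  (\big[mmul/mone]_(j <- r | P j) F j) t = (\sum_(j <- r | P j) F j t)%N.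
Proof.
by apply: (big_morph (fun m : {cmonom I} => m t)) => [m n|]; [rewrite cmM|rewrite cm1].
Qed.

Lemma forest_seq_prod (I : finType) (A : {set I}) (g : I -> rtree) :
  perm_eq (forest_seq (\big[mmul/mone]_(v in A) ucm (g v))) (map g (enum A)).
Proof.
apply/allP => t _ /=; rewrite count_forest_seq cmonom_prodE count_map.
rewrite -sum1_count -big_enum /= [X in _ == X]big_mkcond /=; apply/eqP.
by apply: eq_bigr => v _; rewrite cmU /=; case: eqP.
Qed.

(** Isomorphic branches give equal entries of [forest_seq]. A permutation of the trees therefore has
    to be lifted to positions, so that repeated trees are matched with distinct maximal vertices. *)
Lemma perm_map_lift (I : Type) (J : eqType) (g : I -> J) (x0 : I) (s : seq J) (e : seq I) :
  perm_eq s (map g e) ->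
  exists2 js, perm_eq js (iota 0 (size e)) & s = map g (map (nth x0 e) js).
Proof.
move=> /(perm_iotaP (g x0))[js]; rewrite size_map => pjs ->; exists js => //.
rewrite -map_comp; apply/eq_in_map => j; rewrite (perm_mem pjs) mem_iota /= add0n => jlt.
by rewrite (nth_map x0).
Qed.

Section Graft.
Variables (T : finType) (le : rel T) (r : T).
Hypotheses (fp : forest_poset le) (lex : forall x, le x r).

(** An order embedding [F] of the abstract graft onto [r |: U] is assembled: the new root goes to
    [r], and the [i]-th branch goes isomorphically onto the downset of a maximal vertex [sg i] of
    [U]. *)
Lemma tree_of_add_root (U : {set T}) : r \notin U ->
  tree_of (induced_le le (C := r |: U)) = graft (forest_of le U).
Proof.
have [lexx leas letr lech] := fp => rU; set s := forest_seq (forest_of le U).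
pose g v := tree_of (induced_le le (C := down le U v)).
have [js pjs sE] : exists2 js, perm_eq js (iota 0 (size (enum (maxs le U)))) &
    s = map g (map (nth r (enum (maxs le U))) js).
  by apply: perm_map_lift; exact: forest_seq_prod.
set e := map _ js in sE.
have pe : perm_eq e (enum (maxs le U)).
  by rewrite -[X in perm_eq _ X](mkseq_nth r); exact: perm_map.
have nthE k : nth (g r) s k = nth (g r) (map g e) k by rewrite -sE.
have ue : uniq e by rewrite (perm_uniq pe) enum_uniq.
have me v : (v \in e) = (v \in maxs le U) by rewrite (perm_mem pe) mem_enum.
have sz : size s = size e by rewrite sE size_map.
pose sg (i : 'I_(size s)) := nth r e i.
have sgmax i : sg i \in maxs le U by rewrite -me mem_nth // -sz.
have sginj : injective sg.
  move=> i j /eqP; rewrite nth_uniq -?sz // => /eqP ij; exact: val_inj.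
have ex i : exists phi : vertex (tnth (in_tuple s) i) -> T,
    (forall x y, vertex_le x y = le (phi x) (phi y)) /\
    phi @: setT = down le U (sg i).
  have -> : tnth (in_tuple s) i = g (sg i).
    by rewrite (tnth_nth (g r)) /= nthE (nth_map r) // -sz.
  have /maxsP[sU _] := sgmax i.
  have [psi psib psile] := poset_iso_sym (tree_ofP (down_rooted fp sU)).
  exists (fun x => val (psi x)); split=> [x y|]; first exact: psile.
  apply/setP => y; apply/imsetP/idP => [[x _ ->]|yD]; first exact: valP.
  have [psi' psiK psi'K] := psib.
  by exists (psi' (Sub y yD)); rewrite ?psi'K.
pose phi i := projT1 (cid (ex i)).
have philE i x y : vertex_le x y = le (phi i x) (phi i y).
  by rewrite /phi; case: (cid _) => ? [].
have phiD i : phi i @: setT = down le U (sg i) by rewrite /phi; case: (cid _) => ? [].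
have phi_down i x : phi i x \in down le U (sg i) by rewrite -phiD imset_f.
have phiU i x : phi i x \in U by have := phi_down i x; rewrite inE => /andP[].
have phi_sg i x : le (phi i x) (sg i) by have := phi_down i x; rewrite inE => /andP[].
pose F (x : option {i : 'I_(size s) & vertex (tnth (in_tuple s) i)}) :=
  if x is Some u then phi (tag u) (tagged u) else r.
have grt := graft_rooted (fun i => vertex_le_rooted (tnth (in_tuple s) i)).
have FE x y : graft_le (fun i => @vertex_le (tnth (in_tuple s) i)) x y = le (F x) (F y).
  case: x y => [[i u]|] [[j v]|] //=; rewrite ?lex ?lexx //; last first.
    apply/esym/negP => rv; case/negP: rU.
    by have <- : phi j v = r by apply: leas; rewrite lex.
  have [ij|nij] := eqVneq i j.
    by subst j; rewrite tagged_asE philE.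
  (* A relation between two branches puts [sg i] and [sg j] above a common vertex; they are then
     comparable, and equal by maximality. *)
  apply/esym/negP => uv; case/eqP: nij; apply: sginj.
  have /maxsP[iU imax] := sgmax i; have /maxsP[jU jmax] := sgmax j.
  case/orP: (lech _ _ _ (phi_sg i u) (letr _ _ _ uv (phi_sg j v))) => H.
    by apply/esym/imax.
  exact: jmax.
have [[grr gra _ _] _] := (rooted_treeP _).1 grt.
(* Injectivity is automatic for a map that reflects the order into an antisymmetric one. *)
have Finj : injective F by move=> x y Fxy; apply: gra; rewrite !FE Fxy lexx.
apply/esym/tree_of_iso => //; apply: (induced_iso Finj FE).
apply/setP => y; rewrite in_setU1; apply/imsetP/orP => [[x _ ->]|].
  by case: x => [[i u]|] /=; [right; exact: phiU|left].
case=> [/eqP ->|yU]; first by exists None.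
have [v vmax yv] := maxs_above fp yU.
have ve : (index v e < size s)%N by rewrite sz index_mem me.
have : y \in phi (Ordinal ve) @: setT by rewrite phiD inE yU /sg /= nth_index ?me.
case/imsetP=> x _ ->.
by exists (Some (Tagged (fun i => vertex (tnth (in_tuple s) i)) x)).
Qed.

(** A nonempty upset is [r |: U] for an upset [U] of the remaining vertices. Adding [r] grafts the
    forest of [U] and leaves the complementary forest unchanged. *)
Lemma upset_sum_root (K : fieldType) :
  upset_sum le K setT = << (ucm (tree_of le), mone) >> +
    malg_map (fun p : forest * forest => (p.1, ucm (graft p.2)))
      (upset_sum le K (~: [set r])).
Proof.
have [lexx leas letr lech] := fp.
rewrite {1}/upset_sum [LHS](bigD1 set0); last first.
  by apply/upsetP; split=> [|x y]; rewrite ?sub0set // inE.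
have -> : forest_of le (setT :\: set0) = ucm (tree_of le).
  rewrite setD0 (forest_of_rooted fp lex (in_setT r)); apply/f_equal/esym/tree_of_iso.
    by apply/rooted_treeP; split=> //; exists r.
  by apply: (@induced_iso _ _ _ _ id) => //; rewrite imset_id.
rewrite forest_of0; apply: f_equal.
rewrite malg_map_sum.
rewrite (reindex_onto (fun U => r |: U) (fun U => U :\ r)) /=; last first.
  move=> U /andP[/upsetP[_ up] /set0Pn[x xU]].
  by rewrite setD1K //; apply: up (lex x).
apply: eq_big => [U|U /andP[_ /eqP UE]].
  apply/andP/idP => [[/andP[/upsetP[_ up] _] /eqP UE]|/upsetP[sU up]].
    have rU : r \notin U by rewrite -UE !inE eqxx.
    apply/upsetP; split.
      by apply/subsetP => x xU; rewrite !inE; apply: contraNneq rU => <-.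
    move=> x y xU; rewrite !inE => yr xy.
    by have := up x y; rewrite !inE xU orbT (negbTE yr) => /(_ isT isT xy).
  have rU : r \notin U by apply/negP => /(subsetP sU); rewrite !inE eqxx.
  split; last by rewrite setU1K.
  apply/andP; split; last by apply/set0Pn; exists r; rewrite !inE eqxx.
  apply/upsetP; split=> // x y; rewrite !in_setU1 => xU _ xy.
  have [//|yr] := eqVneq y r; case/orP: xU => [/eqP xr|xU] /=.
    by case/eqP: yr; apply: leas; rewrite lex -xr xy.
  by apply: up xU _ xy; rewrite !inE.
have rU : r \notin U by rewrite -UE !inE eqxx.
rewrite malg_mapU /= (_ : setT :\: (r |: U) = ~: [set r] :\: U); last first.
  by apply/setP => x; rewrite !inE negb_or andbT andbC.
have -> : forest_of le (r |: U) = ucm (graft (forest_of le U)).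
  by rewrite (forest_of_rooted fp lex (setU11 r U)) (tree_of_add_root rU).
reflexivity.
Qed.

End Graft.

Lemma upset_sum_iso (K : fieldType) (S T : finType) (le' : rel S) (le : rel T) :
  forest_poset le' -> poset_iso le' le -> upset_sum le' K setT = upset_sum le K setT.
Proof.
move=> fp [f fb fle]; rewrite -(upset_sum_imset (bij_inj fb) fle fp).
by congr upset_sum; apply/esym/setP => y; have [g fK gK] := fb; rewrite inE -[y]gK imset_f.
Qed.

(** The cocycle identity on one forest: [upset_sum_root] removes the new root, and the remaining sum
    factors over the pairwise unrelated branches. *)
Lemma coproduct_graft (K : fieldType) (f : forest) :
  coproduct_tree K (graft f) = << (ucm (graft f), mone) >> +
    malg_map (fun p : forest * forest => (p.1, ucm (graft p.2)))
      (\prod_(t <- forest_seq f) coproduct_tree K t).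
Proof.
pose V i := vertex (tnth (in_tuple (forest_seq f)) i).
pose le := graft_le (fun i => @vertex_le (tnth (in_tuple (forest_seq f)) i)).
have rt : rooted_tree le by apply: graft_rooted => i; exact: vertex_le_rooted.
have fp := rooted_forest_poset rt; have [lexx _ _ _] := fp.
have lex x : le x None by case: x.
rewrite coproduct_treeE -(upset_sum_iso K fp (tree_ofP rt)) (upset_sum_root fp lex).
congr (_ + malg_map _ _).
pose emb i (x : V i) : option {i & V i} := Some (Tagged V x).
have embinj i : injective (@emb i).
  by move=> x y [] /eqP; rewrite -tag_eqE /tag_eq /= eqxx tagged_asE => /eqP.
have emble i x y : vertex_le x y = le (@emb i x) (@emb i y).
  by rewrite /le /= eqxx tagged_asE.
have -> : ~: [set None] = \bigcup_(i <- index_enum _) (@emb i @: setT).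
  apply/setP => x; rewrite !inE; apply/idP/bigcupP => [|[i _ /imsetP[y _ ->]]//].
  by case: x => [[i x]|//] _; exists i => //; apply: imset_f.
rewrite upset_sum_bigcup ?index_enum_uniq //; last first.
  move=> i j ij _ _ /imsetP[x _ ->] /imsetP[y _ ->].
  by rewrite /le /= (negbTE ij) eq_sym (negbTE ij).
rewrite [RHS](big_nth (tree_of le)) big_mkord; apply: eq_bigr => i _.
rewrite (upset_sum_imset (@embinj i) (emble i)); last first.
  exact/rooted_forest_poset/vertex_le_rooted.
by rewrite -coproduct_treeE (tnth_nth (tree_of le)).
Qed.

Lemma malg_mapZ (K : fieldType) (M L : conomType) (h : M -> L) c (a : {malg K[M]}) :
  malg_map h (c *: a) = c *: malg_map h a.
Proof.
rewrite -2!mul_malgC {1}[a]monalgE mulr_sumr malg_map_sum malg_mapE mulr_sumr.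
apply: eq_bigr => m _.
rewrite malgU_mulC mulrA -mpolyCM -malgU_mulC malg_mapU.
by rewrite malgU_mulC mpolyCM -mulrA -malgU_mulC.
Qed.

Lemma malg_evalU (K : fieldType) (I : choiceType) (L : conomType)
    (d : I -> {malg K[L]}) c (m : {cmonom I}) :
  malg_eval d << c *g m >> = c *: \prod_(t <- finsupp m) d t ^+ m t.
Proof. by rewrite malg_evalE mmapU mul_malgC. Qed.

Lemma prod_forest_seq (C : comNzRingType) (d : rtree -> C) (f : forest) :
  \prod_(t <- forest_seq f) d t = \prod_(t <- finsupp f) d t ^+ f t.
Proof.
rewrite /forest_seq big_flatten big_map; apply: eq_bigr => t _.
by rewrite big_nseq iter_mulr_1.
Qed.

Lemma prod_ucm (C : comNzRingType) (d : rtree -> C) (t : rtree) :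
  \prod_(u <- finsupp (ucm t)) d u ^+ ucm t u = d t.
Proof. by rewrite mdomU big_seq_fset1 cmUU expr1. Qed.

(** * The cocycle identity *)

Section MalgCocycle.
Variables (K : fieldType) (I : choiceType) (L : conomType) (d : I -> {malg K[L]}).
Variables (beta : {cmonom I} -> {cmonom I}) (i : {cmonom I} -> L) (gamma : L -> L).
Hypothesis cocycle : forall f, malg_eval d << beta f >> =
  << i (beta f) >> + malg_map gamma (\prod_(t <- finsupp f) d t ^+ f t).

(** Both sides are linear in [a], so the identity on monomials suffices. *)
Lemma malg_cocycle (a : {malg K[cmonom I]}) :
  malg_eval d (malg_map beta a) =
  malg_map i (malg_map beta a) + malg_map gamma (malg_eval d a).
Proof.
have [_ _ evalD] := malg_eval_multiplicative d.
have eval0 : malg_eval d 0 = 0.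
  by apply: (addrI (malg_eval d 0)); rewrite -evalD !addr0.
have eval_sum := big_morph _ evalD eval0.
have -> : malg_map gamma (malg_eval d a) =
    \sum_(f <- msupp a) a@_f *: malg_map gamma (\prod_(t <- finsupp f) d t ^+ f t).
  by rewrite {1}/malg_eval malg_map_sum; apply: eq_bigr => f _; rewrite malg_mapZ.
rewrite malg_mapE eval_sum malg_map_sum -big_split; apply: eq_bigr => f _ /=.
rewrite malg_mapU malg_evalU.
move: (cocycle f); rewrite malg_evalU scale1r => ->.
by rewrite scalerDr (malgU_mulC a@_f (i _)) mul_malgC.
Qed.

End MalgCocycle.

Section Cocycle.
Variable K : fieldType.

Definition tensorl : HK K -> HK2 K :=
  malg_map (fun f : forest => (f, mone) : forest * forest).
Definition tensorr : HK K -> HK2 K :=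
  malg_map (fun f : forest => (mone, f) : forest * forest).
Definition id_Bplus : HK2 K -> HK2 K :=
  malg_map (fun q : forest * forest => (q.1, ucm (graft q.2)) : forest * forest).

Lemma BplusE (a : HK K) : Bplus a = malg_map (fun f => ucm (graft f)) a.
Proof.
by rewrite malg_mapE; apply: eq_bigr => f _; rewrite -mul_malgC -malgU_mulC.
Qed.

Lemma id_Bplus_tensor a b :
  id_Bplus (tensorl a * tensorr b) = tensorl a * tensorr (Bplus b).
Proof.
rewrite BplusE; apply: malg_map_tensor => f g.
by rewrite (pair_mmul1 f g) (pair_mmul1 f (ucm (graft g))).
Qed.

Lemma coproductE (a : HK K) : coproduct a = malg_eval (@coproduct_tree K) a.
Proof. by []. Qed.

Lemma coproduct_Bplus (a : HK K) :
  coproduct (Bplus a) = tensorl (Bplus a) + id_Bplus (coproduct a).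
Proof.
rewrite BplusE; apply: malg_cocycle => f.
by rewrite malg_evalU scale1r prod_ucm coproduct_graft prod_forest_seq.
Qed.

End Cocycle.

(** * Real powers of power series *)

Import Num.Theory.

Lemma bump0 k : bump 0 k = k.+1. Proof. by []. Qed.

Section Truncation.
Variable A : comNzRingType.
Implicit Types (p q F G : {poly A}) (N : nat).

(** Congruence modulo ['X^(N.+1)]: power series are represented by polynomials read up to degree
    [N]. *)
Definition eqX N p q : Prop := forall i, (i <= N)%N -> p`_i = q`_i.

Lemma eqX_sym N p q : eqX N p q -> eqX N q p.
Proof. by move=> pq i iN; rewrite pq. Qed.

Lemma eqX_trans N q p r : eqX N p q -> eqX N q r -> eqX N p r.
Proof. by move=> pq qr i iN; rewrite pq ?qr. Qed.

Lemma eqXD N p p' q q' : eqX N p p' -> eqX N q q' -> eqX N (p + q) (p' + q').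
Proof. by move=> pp qq i iN; rewrite !coefD pp ?qq. Qed.

Lemma eqXM N p p' q q' : eqX N p p' -> eqX N q q' -> eqX N (p * q) (p' * q').
Proof.
move=> pp qq i iN; rewrite !coefM; apply: eq_bigr => k _.
by rewrite pp ?qq // (leq_trans _ iN) // ?leq_subr // -ltnS.
Qed.

Lemma eqX_exp N p q j : eqX N p q -> eqX N (p ^+ j) (q ^+ j).
Proof. by move=> pq; elim: j => // j IH; rewrite !exprS; exact: eqXM. Qed.

Lemma eqX_sum N (I : Type) (r : seq I) (P : pred I) (p q : I -> {poly A}) :
  (forall i, P i -> eqX N (p i) (q i)) ->
  eqX N (\sum_(i <- r | P i) p i) (\sum_(i <- r | P i) q i).
Proof. by move=> pq i iN; rewrite !coef_sum; apply: eq_bigr => k /pq ->. Qed.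

Lemma coef_exp_lt p i j : p`_0 = 0 -> (i < j)%N -> (p ^+ j)`_i = 0.
Proof.
move=> p0; elim: j i => // j IH i; rewrite ltnS => ij.
rewrite exprS coefM big_ord_recl /= p0 mul0r add0r big1 // => k _.
by rewrite IH ?mulr0 // (leq_trans _ ij) // bump0 subnSK // leq_subr.
Qed.

(** Unlike the plain derivative, this derivation preserves degrees, so differential equations lose
    no precision under truncation. *)
Definition euler p : {poly A} := 'X * p^`().

Lemma coef_euler p i : (euler p)`_i = p`_i *+ i.
Proof. by rewrite coefXM; case: i => [|i] //; rewrite coef_deriv. Qed.

Lemma eulerM p q : euler (p * q) = euler p * q + p * euler q.
Proof. by rewrite /euler derivM; ring. Qed.

End Truncation.

Section BinomialSeries.
Variables (A : comNzRingType) (R : realType) (psi : {rmorphism R -> A}).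
Implicit Types (F G H : {poly A}) (a b : R) (N : nat).

(** Through [psi] the ring [A] is an algebra over the reals, so positive integers are invertible in
    it. *)
Lemma mulrnS_eq0 (u : A) n : u *+ n.+1 = 0 -> u = 0.
Proof.
move=> un; rewrite -[u]mul1r -(rmorph1 psi) -(@mulVf R n.+1%:R); last first.
  by rewrite pnatr_eq0.
by rewrite rmorphM rmorph_nat -mulrA mulr_natl un mulr0.
Qed.

Lemma gbinomS a j : j.+1%:R * gbinom a j.+1 = (a - j%:R) * gbinom a j.
Proof.
rewrite /gbinom big_ord_recr /= factS natrM invfM.
have : (j.+1%:R : R) != 0 by rewrite pnatr_eq0.
have : (j`!%:R : R) != 0 by rewrite pnatr_eq0 -lt0n fact_gt0.
by move=> ? ?; field; rewrite nat1r; apply/andP.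
Qed.

Lemma gbinom0 a : gbinom a 0 = 1.
Proof. by rewrite /gbinom big_ord0 fact0 divr1. Qed.

(* The binomial series of [F ^ a], for [F] with constant term [1]; only the
   coefficients of degree at most [N] are meaningful. *)
Definition bpow N a F : {poly A} :=
  \sum_(j < N.+1) (psi (gbinom a j))%:P * (F - 1) ^+ j.

Lemma coef0_sub1 F : F`_0 = 1 -> (F - 1)`_0 = 0.
Proof. by move=> F0; rewrite coefB F0 coef1 subrr. Qed.

Lemma bpow_coef0 N a F : F`_0 = 1 -> (bpow N a F)`_0 = 1.
Proof.
move=> F0; rewrite /bpow big_ord_recl /= gbinom0 rmorph1 expr0 mulr1 coefD coef1.
rewrite coef_sum big1 ?addr0 // => j _.
by rewrite coefCM coef_exp_lt ?mulr0 // coef0_sub1.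
Qed.

Lemma bpow_congr N a F G : eqX N F G -> eqX N (bpow N a F) (bpow N a G).
Proof.
move=> FG; apply: eqX_sum => j _; apply: eqXM => //; apply: eqX_exp.
by apply: eqXD.
Qed.

Lemma bpow_le n N a F : (n <= N)%N -> F`_0 = 1 -> eqX n (bpow N a F) (bpow n a F).
Proof.
move=> nN F0 i iN; rewrite /bpow !coef_sum.
rewrite -(big_mkord predT (fun j => ((psi (gbinom a j))%:P * (F - 1) ^+ j)`_i)).
rewrite (big_cat_nat (n := n.+1)) //= big_mkord [X in _ + X]big_nat.
rewrite [X in _ + X]big1 ?addr0 // => j /andP[nj _].
by rewrite coefCM coef_exp_lt ?mulr0 ?coef0_sub1 // (leq_ltn_trans iN).
Qed.

Lemma euler_exp G j : euler (G ^+ j.+1) = (j.+1%:R)%:P * G ^+ j * euler G.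
Proof.
rewrite /euler deriv_exp /= -mulr_natl -polyC_natr.
by rewrite polyC_natr; ring.
Qed.

Lemma euler_sum N (u : nat -> A) G :
  euler (\sum_(j < N.+1) (u j)%:P * G ^+ j) =
  (\sum_(j < N) (u j.+1 * j.+1%:R)%:P * G ^+ j) * euler G.
Proof.
rewrite /euler raddf_sum /= mulr_sumr big_ord_recl /= expr0 mulr1 derivC mulr0 add0r.
rewrite mulr_suml; apply: eq_bigr => j _; rewrite bump0 deriv_mulC.
have := euler_exp G j; rewrite /euler => E.
by rewrite mulrCA E polyCM !mulrA.
Qed.

(** With [G = F - 1], [gbinomS] makes the coefficients of [G ^+ j * euler G] agree for [j < N]; only
    terms in [G ^+ N * euler G] differ. *)
Lemma bpow_ode N a F : F`_0 = 1 ->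
  eqX N (F * euler (bpow N a F)) ((psi a)%:P * euler F * bpow N a F).
Proof.
move=> F0; set G := F - 1; have FE : F = 1 + G by rewrite /G addrC subrK.
have eF : euler F = euler G by rewrite /euler /G derivB derivC subr0.
set u := fun j => psi (gbinom a j); set S := \sum_(j < N) (u j)%:P * G ^+ j.
have -> : bpow N a F = S + (u N)%:P * G ^+ N by rewrite /bpow big_ord_recr.
have -> : F * euler (S + (u N)%:P * G ^+ N) =
    ((psi a)%:P * S + (N%:R * u N)%:P * G ^+ N) * euler G.
  have -> : S + (u N)%:P * G ^+ N = \sum_(j < N.+1) (u j)%:P * G ^+ j.
    by rewrite big_ord_recr.
  rewrite euler_sum mulrA; congr (_ * _); rewrite FE mulrDl mul1r.
  suff : \sum_(j < N) (u j.+1 * j.+1%:R)%:P * G ^+ j +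
    \sum_(j < N.+1) (u j * j%:R)%:P * G ^+ j = (psi a)%:P * S + (N%:R * u N)%:P * G ^+ N.
    move=> <-; congr (_ + _); rewrite big_ord_recl /= mulr0 mul0r add0r mulr_sumr.
    by apply: eq_bigr => j _; rewrite bump0 exprS mulrCA.
  rewrite big_ord_recr /= addrA (mulrC (u N)); congr (_ + _).
  rewrite -big_split mulr_sumr; apply: eq_bigr => j _ /=.
  rewrite -mulrDl mulrA -polyCD -polyCM; congr (_%:P * _).
  rewrite /u -!(rmorph_nat psi) -!rmorphM -rmorphD; congr (psi _).
  by rewrite mulrC gbinomS; ring.
rewrite eF; set e := euler G.
(* [G ^+ N] starts in degree [N] and [euler G] in degree 1, so the product is invisible up to degree
   [N]. *)
have tail c : eqX N ((c%:P * G ^+ N) * e) 0.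
  move=> i iN; rewrite coef0 -mulrA coefCM coefM big1 ?mulr0 // => k _.
  have [kN|kN] := ltnP k N; first by rewrite coef_exp_lt ?mul0r // coef0_sub1.
  have -> : (i - k = 0)%N by apply/eqP; rewrite subn_eq0 (leq_trans iN).
  by rewrite coef_euler mulr0n mulr0.
have -> : (psi a)%:P * e * (S + (u N)%:P * G ^+ N) =
  (psi a)%:P * S * e + (psi a * u N)%:P * G ^+ N * e by rewrite polyCM; ring.
by rewrite mulrDl; apply: eqXD => //; apply: eqX_trans (tail _) (eqX_sym (tail _)).
Qed.

(** The difference of two solutions solves the same linear equation. In degree [i.+1], since [F] has
    constant term 1 and [euler F] has none, it expresses [i.+1] times the next coefficient through
    lower ones, which vanish by induction. *)
Lemma ode_unique N (c : A) F G H : F`_0 = 1 -> G`_0 = H`_0 ->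
  eqX N (F * euler G) (c%:P * euler F * G) ->
  eqX N (F * euler H) (c%:P * euler F * H) -> eqX N G H.
Proof.
move=> F0 GH0 odeG odeH.
have ode i : (i <= N)%N -> (F * euler (G - H))`_i = (c%:P * euler F * (G - H))`_i.
  move=> iN; have := odeG i iN; have := odeH i iN.
  by rewrite /euler derivB !mulrBr !coefB => -> ->.
move=> i; have [n] := ubnP i; elim: n i => // n IH i; rewrite ltnS => lin iN.
apply/eqP; rewrite -subr_eq0 -coefB; apply/eqP; case: i iN lin => [|i] iN lin.
  by rewrite coefB GH0 subrr.
have E0 k : (k <= i)%N -> (G - H)`_k = 0.
  by move=> ki; rewrite coefB IH ?subrr //; [exact: leq_trans lin|exact: leq_trans (leqW ki) iN].
apply: (@mulrnS_eq0 _ i); have := ode i.+1 iN.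
rewrite coefM big_ord_recl /= subn0 F0 mul1r coef_euler big1 ?addr0.
  move=> ->; rewrite coefM big_ord_recl /= coefCM coef_euler mulr0n mulr0 mul0r add0r.
  by rewrite big1 // => k _; rewrite E0 ?mulr0 // bump0 subSS leq_subr.
by move=> k _; rewrite coef_euler bump0 subSS E0 ?leq_subr // mul0rn mulr0.
Qed.

(** Both sides have constant term 1 and solve the differential equation for the exponent [a + b].
    The laws up to [bpow0] follow the same pattern. *)
Lemma bpowD N a b F : F`_0 = 1 ->
  eqX N (bpow N (a + b) F) (bpow N a F * bpow N b F).
Proof.
move=> F0; apply: (@ode_unique N (psi (a + b)) F) => //.
- by rewrite coef0M !bpow_coef0 // mulr1.
- exact: bpow_ode.
rewrite eulerM rmorphD polyCD.
set P := bpow N a F; set Q := bpow N b F.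
have -> : F * (euler P * Q + P * euler Q) = F * euler P * Q + F * euler Q * P by ring.
have -> : ((psi a)%:P + (psi b)%:P) * euler F * (P * Q) =
  (psi a)%:P * euler F * P * Q + (psi b)%:P * euler F * Q * P by ring.
by apply: eqXD; apply: eqXM => //; exact: bpow_ode.
Qed.

Lemma bpowM N a F G : F`_0 = 1 -> G`_0 = 1 ->
  eqX N (bpow N a (F * G)) (bpow N a F * bpow N a G).
Proof.
move=> F0 G0; have FG0 : (F * G)`_0 = 1 by rewrite coef0M F0 G0 mulr1.
apply: (@ode_unique N (psi a) (F * G)) => //.
- by rewrite coef0M !bpow_coef0 // mulr1.
- exact: bpow_ode.
rewrite !eulerM; set P := bpow N a F; set Q := bpow N a G.
have -> : F * G * (euler P * Q + P * euler Q) =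
  F * euler P * (G * Q) + G * euler Q * (F * P) by ring.
have -> : (psi a)%:P * (euler F * G + F * euler G) * (P * Q) =
  (psi a)%:P * euler F * P * (G * Q) + (psi a)%:P * euler G * Q * (F * P) by ring.
by apply: eqXD; apply: eqXM => //; exact: bpow_ode.
Qed.

Lemma bpow1 N F : F`_0 = 1 -> eqX N (bpow N 1 F) F.
Proof.
move=> F0; apply: (@ode_unique N (psi 1) F) => //; first by rewrite bpow_coef0.
  exact: bpow_ode.
by rewrite rmorph1 mul1r mulrC.
Qed.

Lemma bpow0 N F : F`_0 = 1 -> eqX N (bpow N 0 F) 1.
Proof.
move=> F0; apply: (@ode_unique N (psi 0) F) => //.
- by rewrite bpow_coef0 // coef1.
- exact: bpow_ode.
by rewrite rmorph0 !mul0r /euler derivC !mulr0.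
Qed.

Lemma bpow_natmul N a k F : F`_0 = 1 ->
  eqX N (bpow N (k%:R * a) F) (bpow N a F ^+ k).
Proof.
move=> F0; elim: k => [|k IH]; first by rewrite mul0r; exact: bpow0.
rewrite -natr1 mulrDl mul1r addrC exprS.
by apply: eqX_trans; [exact: bpowD|exact: eqXM].
Qed.

End BinomialSeries.

Section BinomialSeriesMap.
Variables (A B : comNzRingType) (R : realType).
Variables (psiA : {rmorphism R -> A}) (psiB : {rmorphism R -> B}) (f : {rmorphism A -> B}).
Hypothesis f_psi : forall c, f (psiA c) = psiB c.

Lemma map_bpow N a F : map_poly f (bpow psiA N a F) = bpow psiB N a (map_poly f F).
Proof.
rewrite /bpow rmorph_sum; apply: eq_bigr => j _ /=.
by rewrite rmorphM rmorphXn rmorphB rmorph1 /= map_polyC /= f_psi.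
Qed.

End BinomialSeriesMap.

Section Composition.
Variables (A : comNzRingType) (R : realType) (psi : {rmorphism R -> A}).
Implicit Types (P Q S : {poly A}).

Lemma bpow_comp N a P Q : bpow psi N a (P \Po Q) = bpow psi N a P \Po Q.
Proof.
rewrite /bpow raddf_sum; apply: eq_bigr => j _ /=.
rewrite comp_polyM comp_polyC; congr (_ * _).
have -> : P \Po Q - 1 = (P - 1) \Po Q by rewrite comp_polyB comp_polyC.
by elim: (j : nat) => [|k IH]; rewrite ?expr0 ?comp_polyC // !exprS comp_polyM IH.
Qed.

(** Substituting [Q * 'X] multiplies the degree [m] coefficient of [P] by [Q ^+ m]: this realises
    the rescaling [Z(Q)]. Terms with [m > n] are divisible by ['X^m] and drop out. *)
Lemma coef_comp_mulX S P Q n :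
  (S * (P \Po (Q * 'X)))`_n = \sum_(m < n.+1) P`_m * (S * Q ^+ m)`_(n - m).
Proof.
set M := maxn (size P) n.+1.
have -> : P \Po (Q * 'X) = \sum_(m < M) (P`_m)%:P * (Q * 'X) ^+ m.
  rewrite /comp_poly (@horner_coef_wide _ M); last first.
    by rewrite (leq_trans (size_poly _ _)) // leq_maxl.
  by apply: eq_bigr => m _; rewrite coef_map.
rewrite mulr_sumr coef_sum.
rewrite -(big_mkord predT (fun m => (S * ((P`_m)%:P * (Q * 'X) ^+ m))`_n)).
rewrite (big_cat_nat (n := n.+1)) ?leq_maxr //= big_mkord [X in _ + X]big_nat.
rewrite [X in _ + X]big1 ?addr0 => [|m /andP[nm _]].
  apply: eq_bigr => m _; rewrite mulrCA coefCM exprMn mulrA coefMXn ltnNge -ltnS.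
  by rewrite ltn_ord.
by rewrite mulrCA coefCM exprMn mulrA coefMXn nm mulr0.
Qed.

End Composition.

(** * The Dyson-Schwinger equation *)

Section SeriesPower.
Variables (H : comNzRingType) (R : realType) (psi : {rmorphism R -> H}).
Variable x : nat -> H.
Hypothesis x0 : x 0%N = 1.

Definition trunc_series (N : nat) : {poly H} := \poly_(i < N.+1) x i.

(** The degree [n] part of the [a]-th power of the series; by [series_powE] any longer truncation
    gives the same value. *)
Definition series_pow (a : R) (n : nat) : H := (bpow psi n a (trunc_series n))`_n.

Lemma trunc_series0 N : (trunc_series N)`_0 = 1.
Proof. by rewrite coef_poly. Qed.

Lemma series_powE (a : R) n N : (n <= N)%N ->
  (bpow psi N a (trunc_series N))`_n = series_pow a n.
Proof.
move=> nN; rewrite (bpow_le _ _ nN (trunc_series0 N)) //.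
apply: bpow_congr (leqnn n) => i iN.
by rewrite !coef_poly !ltnS iN (leq_trans iN nN).
Qed.

End SeriesPower.

Section DysonSchwinger.
Variables (H A : comNzRingType) (R : realType).
Variables (psiH : {rmorphism R -> H}) (psi : {rmorphism R -> A}).
Variables (i1 i2 D : {rmorphism H -> A}) (B : H -> H) (L : {additive A -> A}).
Hypotheses (i1_psi : forall c, i1 (psiH c) = psi c)
           (i2_psi : forall c, i2 (psiH c) = psi c)
           (D_psi : forall c, D (psiH c) = psi c).
Hypothesis LB : forall a b, L (i1 a * i2 b) = i1 a * i2 (B b).
Hypothesis DB : forall a, D (B a) = i1 (B a) + L (D a).
Variables (p : R) (x : nat -> H).
Hypotheses (x0 : x 0%N = 1) (xS : forall n, x n.+1 = B (series_pow psiH x p n)).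

(** Here [i1] and [i2] stand for the two embeddings into the tensor square, [D] for the coproduct,
    [B] for [Bplus] and [L] for [id_Bplus]. The degree is recorded by the polynomial variable. *)
Lemma dyson_schwinger_coproduct n :
  D (x n) = i1 (x n) +
    \sum_(k < n) i1 (series_pow psiH x (k.+1%:R * (p - 1) + 1) (n - k.+1)) * i2 (x k.+1).
Proof.
have [m] := ubnP n; elim: m n => // m IH [|n]; rewrite ltnS => nm.
  by rewrite big_ord0 addr0 x0 !rmorph1.
rewrite {1}xS DB -xS; congr (_ + _).
set X := trunc_series x n.
pose Y := map_poly i1 X; pose Z := map_poly i2 X; pose W := map_poly D X.
pose Q := bpow psi n (p - 1) Y; pose V := Z \Po (Q * 'X).
have X0 : X`_0 = 1 by exact: trunc_series0.
have Y0 : Y`_0 = 1 by rewrite coef_map /= X0 rmorph1.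
have Q0 : Q`_0 = 1 by exact: bpow_coef0.
have Yk k i : (i <= n)%N ->
    (bpow psi n (k%:R * (p - 1)) Y)`_i = (Q ^+ k)`_i by exact: bpow_natmul.
have V0 : V`_0 = 1.
  have := coef_comp_mulX 1 Z Q 0; rewrite mul1r big_ord1 expr0 mulr1 coef1 mulr1 => ->.
  by rewrite coef_map /= X0 rmorph1.
have powY a i : (i <= n)%N -> (bpow psi n a Y)`_i = i1 (series_pow psiH x a i).
  by move=> iN; rewrite -(map_bpow i1_psi) coef_map series_powE.
(* The induction hypothesis in closed form: the exponent [k * (p - 1) + 1] splits as [Y * Q ^+ k],
   and the separate term [i1 (x i)] is the contribution of [k = 0]. *)
have WE : eqX n W (Y * V).
  move=> i iN; rewrite coef_comp_mulX coef_map coef_poly ltnS iN /=.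
  rewrite IH; last exact: leq_ltn_trans nm.
  rewrite big_ord_recl expr0 mulr1 subn0 !coef_map !coef_poly /= x0 rmorph1 mul1r.
  rewrite ltnS iN; congr (_ + _); apply: eq_bigr => k _; rewrite /bump /= add1n.
  rewrite coef_map coef_poly ltnS (leq_trans (ltn_ord k) iN) mulrC; congr (_ * _).
  have sN : (i - k.+1 <= n)%N by rewrite (leq_trans (leq_subr _ _)).
  rewrite -powY // addrC (bpowD psi _ _ Y0) //.
  by apply: (eqXM (N := n)) sN; [exact: bpow1|exact: bpow_natmul].
have -> : D (series_pow psiH x p n) = (bpow psi n p W)`_n.
  by rewrite -(map_bpow D_psi) coef_map.
rewrite (bpow_congr psi p WE) // (bpowM psi p Y0 V0) // bpow_comp coef_comp_mulX.
rewrite raddf_sum; apply: eq_bigr => k _; rewrite subSS.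
have kn : (k <= n)%N by rewrite -ltnS.
rewrite -(map_bpow i2_psi) coef_map series_powE // mulrC.
have -> : (bpow psi n p Y * Q ^+ k)`_(n - k) =
    i1 (series_pow psiH x (k.+1%:R * (p - 1) + 1) (n - k)).
  (* The shift of index caused by [B] is absorbed here: the factor [Y^p * Q^k] has the exponent
     required for [x k.+1]. *)
  have -> : k.+1%:R * (p - 1) + 1 = p + k%:R * (p - 1) by rewrite -natr1; ring.
  rewrite -powY ?leq_subr // (bpowD psi _ _ Y0) ?leq_subr //; symmetry.
  by apply: (eqXM (N := n)) (leq_subr _ _) => //; exact: bpow_natmul.
by rewrite LB -xS.
Qed.

End DysonSchwinger.

(** * The multinomial theorem and the explicit coefficients *)

Section Multinomial.
Variables (A : comNzRingType) (R : realType) (psi : {rmorphism R -> A}).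

(** The exponential series of [y * 'X], truncated at degree [J]. *)
Definition divpow (J : nat) (y : A) : {poly A} :=
  \sum_(i < J.+1) (psi (i`!%:R^-1) * y ^+ i)%:P * 'X^i.

Lemma coef_divpow J y i : (i <= J)%N -> (divpow J y)`_i = psi (i`!%:R^-1) * y ^+ i.
Proof.
move=> iJ; rewrite /divpow coef_sum (bigD1 (Ordinal (iJ : (i < J.+1)%N))) //=.
rewrite coefCM coefXn eqxx mulr1 big1 ?addr0 // => j nji.
by rewrite coefCM coefXn eq_sym (negbTE (_ : (j : nat) != i)) ?mulr0.
Qed.

Lemma divpowD J y z : eqX J (divpow J (y + z)) (divpow J y * divpow J z).
Proof.
move=> i iJ; rewrite coef_divpow // coefM addrC exprDn mulr_sumr; apply: eq_bigr => k _.
have ki : (k <= i)%N by rewrite -ltnS.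
rewrite !coef_divpow ?(leq_trans _ iJ) // ?leq_subr //.
have fne m : (m`!%:R : R) != 0 by rewrite pnatr_eq0 -lt0n fact_gt0.
have -> : psi i`!%:R^-1 = psi ((k`!%:R)^-1 * ((i - k)`!%:R)^-1 / ('C(i, k))%:R).
  congr (psi _); rewrite -(bin_fact ki) !natrM.
  have := fne k; have := fne (i - k)%N.
  have : ('C(i, k)%:R : R) != 0 by rewrite pnatr_eq0 -lt0n bin_gt0.
  by move=> ? ? ?; field; apply/and3P.
rewrite mulrnAr -mulrnAl -rmorphMn -mulr_natr mulfVK; last first.
  by rewrite pnatr_eq0 -lt0n bin_gt0.
by rewrite rmorphM [z ^+ _ * _]mulrC mulrACA.
Qed.

Lemma divpow_sum J (I : Type) (r : seq I) (y : I -> A) :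
  eqX J (divpow J (\sum_(i <- r) y i)) (\prod_(i <- r) divpow J (y i)).
Proof.
elim: r => [|i r IH].
  rewrite !big_nil => k kJ; rewrite coef_divpow // coef1 expr0n.
  by case: k kJ => [|k] _; rewrite ?mulr0 // fact0 invr1 rmorph1 mulr1.
rewrite !big_cons; apply: eqX_trans; first exact: divpowD.
exact: eqXM.
Qed.

(** Compare coefficients of degree [j] in the identity turning the exponential of a sum into a
    product. Bounding exponents by [J] instead of [j] keeps the index type fixed while [j]
    varies. *)
Lemma multinomial_theorem (m J j : nat) (y : 'I_m -> A) : (j <= J)%N ->
  (\sum_l y l) ^+ j =
  \sum_(f : {ffun 'I_m -> 'I_J.+1} | (\sum_l f l == j)%N)
     psi (j`!%:R / \prod_l (f l)`!%:R) * \prod_l y l ^+ f l.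
Proof.
move=> jJ; have fne k : (k`!%:R : R) != 0 by rewrite pnatr_eq0 -lt0n fact_gt0.
have := @divpow_sum J _ (index_enum _) y j jJ; rewrite coef_divpow //.
rewrite (bigA_distr_bigA (fun l (i : 'I_J.+1) => (psi (i`!%:R^-1) * y l ^+ i)%:P * 'X^i)).
rewrite coef_sum => E.
have -> : (\sum_l y l) ^+ j = psi j`!%:R * (psi j`!%:R^-1 * (\sum_l y l) ^+ j).
  by rewrite mulrA -rmorphM mulfV // rmorph1 mul1r.
rewrite E mulr_sumr [RHS]big_mkcond; apply: eq_bigr => f _.
rewrite big_split /= -rmorph_prod prodrXr /= coefCM coefXn eq_sym.
case: eqP => _; last by rewrite !mulr0.
rewrite mulr1 big_split /= mulrA; congr (_ * _).
by rewrite -rmorph_prod -rmorphM prodfV.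
Qed.

End Multinomial.

Section DseCoeff.
Variables (H : comNzRingType) (R : realType) (psi : {rmorphism R -> H}).
Variable x : nat -> H.
Hypothesis x0 : x 0%N = 1.

Lemma trunc_series_sub1 m :
  trunc_series x m - 1 = \sum_(l < m) (x l.+1)%:P * 'X^(l.+1).
Proof.
rewrite /trunc_series poly_def big_ord_recl x0 scale1r expr0 addrC addKr.
by apply: eq_bigr => l _; rewrite mul_polyC lift0.
Qed.

Lemma series_pow_multinomial (a : R) m :
  series_pow psi x a m =
  \sum_(f : {ffun 'I_m -> 'I_m.+1} | (\sum_(l < m) l.+1 * f l == m)%N)
    psi (gbinom a (\sum_l f l)%N *
         ((\sum_l f l)%N`!%:R / \prod_l (f l)`!%:R)) * \prod_(l < m) x l.+1 ^+ f l.
Proof.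
have fsum (f : {ffun 'I_m -> 'I_m.+1}) :
    (\sum_(l < m) l.+1 * f l == m)%N -> (\sum_l f l < m.+1)%N.
  move=> /eqP fm; rewrite ltnS -[leqRHS]fm; apply: leq_sum => l _.
  exact: leq_pmull.
(* Multi-indices are grouped by their total [j]. By [fsum] the default value of [inord] never occurs
   for those of weight [m]. *)
pose sz (f : {ffun 'I_m -> 'I_m.+1}) : 'I_m.+1 := inord (\sum_l f l)%N.
rewrite (partition_big sz predT) //= /series_pow /bpow coef_sum; apply: eq_bigr => j _.
have jm : (j <= m)%N by rewrite -ltnS.
rewrite coefCM trunc_series_sub1.
rewrite (multinomial_theorem [the {rmorphism R -> {poly H}} of polyC \o psi] _ jm).
rewrite coef_sum mulr_sumr big_mkcond [RHS]big_mkcond /=; apply: eq_bigr => f _.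
have -> : \prod_(l < m) ((x l.+1)%:P * 'X^(l.+1)) ^+ f l =
    (\prod_(l < m) x l.+1 ^+ f l)%:P * 'X^(\sum_(l < m) l.+1 * f l)%N.
  rewrite rmorph_prod -prodrXr -big_split; apply: eq_bigr => l _ /=.
  by rewrite exprMn rmorphXn exprM.
rewrite mulrA -polyCM coefCM coefXn [m == _]eq_sym.
have [fm|_] := eqVneq (\sum_(l < m) l.+1 * f l)%N m; last by rewrite !mulr0 if_same.
have -> : (sz f == j) = (\sum_l f l == j)%N.
  by rewrite -val_eqE /= inordK // fsum // fm.
by case: eqP => // ->; rewrite mulr1 mulrA rmorphM.
Qed.

End DseCoeff.

(** The iterate is the body of [fs_exp]: convolution of sequences is polynomial multiplication up to
    degree [N]. *)
Lemma convolution_exp (H : comNzRingType) (a : nat -> H) (P : {poly H}) N j n :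
  (forall i, (i <= N)%N -> a i = P`_i) -> (n <= N)%N ->
  iter j (fun b m => \sum_(i < m.+1) a i * b (m - i)%N) (fun m => (m == 0%N)%:R) n
    = (P ^+ j)`_n.
Proof.
move=> aP; elim: j n => [|j IH] n nN; first by rewrite expr0 coef1.
rewrite exprS coefM /=; apply: eq_bigr => i _.
rewrite -IH ?(leq_trans (leq_subr _ _)) // aP // (leq_trans _ nN) //.
by rewrite -ltnS.
Qed.

Lemma coef_trunc_series_sub1 (H : comNzRingType) (x : nat -> H) N i :
  x 0%N = 1 -> (i <= N)%N ->
  (if i is 0 then 0 else x i) = (trunc_series x N - 1)`_i.
Proof.
move=> x0 iN; rewrite coefB coef_poly coef1 ltnS iN.
by case: i iN => [|i] _ /=; rewrite ?x0 ?subrr ?subr0.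
Qed.

(** * Specialisation to the Connes-Kreimer algebra *)

Section Bialgebra.
Variable K : fieldType.

Lemma tensorl_additive : additive (@tensorl K).
Proof. by apply: raddfB. Qed.
HB.instance Definition _ :=
  GRing.isAdditive.Build (HK K) (HK2 K) (@tensorl K) tensorl_additive.
Lemma tensorl_multiplicative : multiplicative (@tensorl K).
Proof.
split; [apply: malg_mapM => f g|exact: malg_map1].
by rewrite /mmul /= /pair_mmul /= mulm1.
Qed.
HB.instance Definition _ :=
  GRing.isMultiplicative.Build (HK K) (HK2 K) (@tensorl K) tensorl_multiplicative.

Lemma tensorr_additive : additive (@tensorr K).
Proof. by apply: raddfB. Qed.
HB.instance Definition _ :=
  GRing.isAdditive.Build (HK K) (HK2 K) (@tensorr K) tensorr_additive.
Lemma tensorr_multiplicative : multiplicative (@tensorr K).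
Proof.
split; [apply: malg_mapM => f g|exact: malg_map1].
by rewrite /mmul /= /pair_mmul /= mulm1.
Qed.
HB.instance Definition _ :=
  GRing.isMultiplicative.Build (HK K) (HK2 K) (@tensorr K) tensorr_multiplicative.

Lemma coproduct_additive : additive (@coproduct K).
Proof. by move=> a b; rewrite !coproductE !malg_evalE; exact: rmorphB. Qed.
HB.instance Definition _ :=
  GRing.isAdditive.Build (HK K) (HK2 K) (@coproduct K) coproduct_additive.
Lemma coproduct_multiplicative : multiplicative (@coproduct K).
Proof. by have [? ? _] := malg_eval_multiplicative (@coproduct_tree K). Qed.
HB.instance Definition _ :=
  GRing.isMultiplicative.Build (HK K) (HK2 K) (@coproduct K) coproduct_multiplicative.

HB.instance Definition _ :=
  GRing.Additive.copy (@id_Bplus K)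
    (malg_map (fun q : forest * forest => (q.1, ucm (graft q.2)) : forest * forest)).

End Bialgebra.

Lemma tensorlrE (K : fieldType) (a b : HK K) : tensor a b = tensorl a * tensorr b.
Proof. exact: tensorE. Qed.

Lemma tensorr1 (K : fieldType) (a : HK K) : tensor a 1 = tensorl a.
Proof. by rewrite tensorlrE rmorph1 mulr1. Qed.

Section Scalars.
Variables (K : fieldType) (R : realType) (emb : {rmorphism R -> K}).

Definition emb_HK : {rmorphism R -> HK K} := (@malgC forest K \o emb).
Definition emb_HK2 : {rmorphism R -> HK2 K} := (@malgC (forest * forest)%type K \o emb).

Lemma emb_HKE c (a : HK K) : emb_HK c * a = emb c *: a.
Proof. exact: mul_malgC. Qed.

Lemma tensorl_emb c : tensorl (emb_HK c) = emb_HK2 c.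
Proof. exact: malg_mapU. Qed.

Lemma tensorr_emb c : tensorr (emb_HK c) = emb_HK2 c.
Proof. exact: malg_mapU. Qed.

Lemma coproduct_emb c : coproduct (emb_HK c) = emb_HK2 c.
Proof.
by rewrite coproductE malg_evalU mdom1 big_seq_fset0 -mul_malgC mulr1.
Qed.

Variable x : nat -> HK K.
Hypothesis x0 : x 0%N = 1.

Lemma fs_expE N j n : (n <= N)%N ->
  fs_exp (fs_bar x) j n = ((trunc_series x N - 1) ^+ j)`_n.
Proof.
exact: convolution_exp (fun i => coef_trunc_series_sub1 x0).
Qed.

Lemma fs_rpowE p n : fs_rpow emb x p n = series_pow emb_HK x p n.
Proof.
rewrite /series_pow /bpow coef_sum; apply: eq_bigr => j _.
by rewrite coefCM emb_HKE (fs_expE _ (leqnn n)).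
Qed.

Lemma dse_coeffE p n k : (k <= n)%N ->
  dse_coeff emb p x n k = series_pow emb_HK x (k%:R * (p - 1) + 1) (n - k).
Proof.
move=> kn; rewrite /dse_coeff; case: eqVneq => [->|_].
  rewrite subnn /series_pow bpow_coef0 //; exact: trunc_series0.
rewrite series_pow_multinomial //; apply: eq_bigr => i _.
(* The multinomial factor is formed in [K] in [dse_coeff] and in [R] in [series_pow_multinomial];
   being rational, it is preserved by [emb]. *)
have embM j : emb (j`!%:R / \prod_(m < n - k) (i m)`!%:R) =
    j`!%:R / \prod_(m < n - k) (i m)`!%:R.
  rewrite fmorph_div rmorph_nat rmorph_prod; congr (_ / _).
  by apply: eq_bigr => m _; exact: rmorph_nat.
by rewrite emb_HKE rmorphM embM.
Qed.

End Scalars.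

Theorem theorem6p3 (K : fieldType) (charK : [pchar K] =i pred0)
    (R : realType) (emb : {rmorphism R -> K}) (p : R) (x : nat -> HK K) :
  DSE_solution emb p x ->
  forall n : nat, (1 <= n)%N ->
    coproduct (x n) =
      tensor (x n) 1 + \sum_(1 <= k < n.+1) tensor (dse_coeff emb p x n k) (x k).
Proof.
case=> x0 [_ xE] n _.
(* In positive degree the summand [fs_one] vanishes, leaving the recursion used in the abstract
   setting. *)
have xS m : x m.+1 = Bplus (series_pow (emb_HK emb) x p m).
  by rewrite xE -fs_rpowE // /fs_add /fs_one add0r.
rewrite (dyson_schwinger_coproduct (tensorl_emb emb) (tensorr_emb emb)
  (coproduct_emb emb) (@id_Bplus_tensor K) (@coproduct_Bplus K) x0 xS).
rewrite tensorr1 big_add1 big_mkord.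
have -> // : \sum_(k < n) tensor (dse_coeff emb p x n k.+1) (x k.+1) =
  \sum_(k < n) tensorl (series_pow (emb_HK emb) x (k.+1%:R * (p - 1) + 1) (n - k.+1)) *
               tensorr (x k.+1).
by apply: eq_bigr => k _; rewrite dse_coeffE // tensorlrE.
Qed.
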